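(* Let $m\ge1$, let $\alpha\in\mathfrak S_{2m}$ be a chord diagram, and let $A$ be the gentle algebra with one maximal path whose associated quasi-diagram is $\alpha$. Then the following statements are equivalent. (1) $\alpha$ is maximal. (2) $\alpha$ is regular. (3) $\alpha$ is rotatably regular. (4) The $l$-th rotation $\zeta^l\alpha\zeta^{-l}$ of $\alpha$ is maximal for any integer $l$, where $\zeta=(1\,2\cdots 2m)$. (5) The Koszul dual quasi-diagram $\alpha^!$ exists. (6) $\alpha$ is the Koszul dual of a maximal chord diagram. (7) $\operatorname{gldim}A=2m-1$. Moreover, if $\alpha$ is maximal, then $m$ is an even number.
   Context: $k$ is an algebraically closed field of characteristic $0$; all algebras are over $k$ and basic. In a quiver $Q$, an arrow $a$ has source $s(a)$ and target $t(a)$; a path $a_1a_2\cdots a_l$ is composed from left to right, i.e. $t(a_i)=s(a_{i+1})$. An algebra $A$ is locally gentle if $A\cong kQ/I$ where: (1) $Q$ is a finite quiver such that at each vertex at most two arrows end and at most two arrows start; (2) $I$ is generated by paths of length two; (3) for every arrow $a$ there is at most one arrow $b$ such that $ab$ is a path in $I$ and at most one arrow $c$ such that $ca$ is a path in $I$, and there is at most one arrow $b'$ such that $ab'$ is a path not in $I$ and at most one arrow $c'$ such that $c'a$ is a path not in $I$. A gentle algebra is a finite-dimensional locally gentle algebra. A (nonzero) path in $A=kQ/I$ is a path $p$ of $Q$ (possibly trivial) with $p\notin I$; it is maximal if $pa=ap=0$ in $A$ for every arrow $a$. In a gentle algebra every arrow lies in a unique maximal path. ''Gentle algebra with one maximal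 path'' means that $A$ has exactly one maximal path $p$. If $p$ has length $n-1$ and passes successively through the vertices $v_1,\dots,v_n$ of $Q$ (each vertex of $Q$ occurs at most twice in this list), the associated permutation $\alpha\in\mathfrak S_n$ is given by $\alpha(i)=j$ if there is $j\ne i$ with $v_j=v_i$, and $\alpha(i)=i$ otherwise. This gives a bijection between isomorphism classes of gentle algebras with one maximal path and quasi-diagrams. Concretely, $A$ is the subalgebra of the path algebra of the linear quiver $1\to2\to\cdots\to n$ spanned by its radical and the elements $e_i+e_{\alpha(i)}$ ($\alpha(i)\neq i$) and $e_i$ ($\alpha(i)=i$), where $e_i$ is the idempotent at vertex $i$. A quasi-diagram is a permutation $\alpha\in\mathfrak S_n$ with $\alpha^2=\mathrm{id}$; its isolated points are its fixed points; a chord diagram is a quasi-diagram without isolated points. Write $\zeta=(1\,2\cdots n)$; permutations are composed from right to left. $\alpha$ is maximal if $\zeta\alpha$ has only one orbit on $\{1,\dots,n\}$. $\alpha$ is regular if every orbit of $\zeta\alpha$ contains $1$ or at least one isolated point of $\alpha$, and rotatably regular if $\zeta^l\alpha\zeta^{-l}$ is regular for every integer $l$. Koszul dual: a locally gentle algebra $A=kQ/I$, graded by path length, is Koszul, and its Koszul dual (the Yoneda algebra $\operatorname{Ext}_A(A_0,A_0)$) is isomorphic to the locally gentle algebra $A^!=kQ^!/I^!$, where $Q^!$ is the opposite quiver of $Q$ and $I^!$ is generated by the opposites of the paths of length two in $Q$ that do not appear in $I$. For a quasi-diagram $\alpha$ with gentle algebra $A$, the Koszul dual quasi-diagram $\alpha^!$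 exists if $A^!$ is again a gentle algebra with one maximal path; in that case $\alpha^!$ is the quasi-diagram associated to $A^!$. *)

(* Defs.v *)
From HB Require Import structures.
From mathcomp Require Import all_boot all_order all_fingroup all_algebra.
From mathcomp Require Import finmap.
From mathcomp Require Import monalg.

Set Implicit Arguments.
Unset Strict Implicit.
Unset Printing Implicit Defensive.

Import GRing.Theory.
Local Open Scope ring_scope.

(* The point [i] of {1, ..., n} is the ordinal of value [i - 1]. *)

Definition zeta n : 'S_n := perm (@ordS_inj n).

(* MathComp composes permutations from left to right: [(s * t) x = t (s x)].
   [pcomp s t] is the composite "s after t". *)
Definition pcomp n (s t : 'S_n) : 'S_n := (t * s)%g.

Definition zeta_pow n (l : int) : 'S_n :=
  match l with
  | Posz j => (zeta n ^+ j)%g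
  | Negz j => (zeta n ^- j.+1)%g
  end.

Definition rotation n (l : int) (al : 'S_n) : 'S_n :=
  pcomp (zeta_pow n l) (pcomp al (zeta_pow n (- l))).

Definition quasi_diagram n (al : 'S_n) : Prop := forall i, al (al i) = i.

Definition isolated n (al : 'S_n) (i : 'I_n) : Prop := al i = i.

Definition chord_diagram n (al : 'S_n) : Prop :=
  quasi_diagram al /\ forall i, ~ isolated al i.

Definition maximal n (al : 'S_n) : Prop := #|porbits (pcomp (zeta n) al)| = 1%N.

Definition regular n (al : 'S_n) : Prop :=
  forall O, O \in porbits (pcomp (zeta n) al) ->
  exists2 i : 'I_n, i \in O & i = 0%N :> nat \/ isolated al i.

Definition rotatably_regular n (al : 'S_n) : Prop :=
  forall l : int, regular (rotation l al).

Record quiver := Quiver {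
  vertex : finType;
  arrow : finType;
  source : arrow -> vertex;
  target : arrow -> vertex
}.

Section Paths.
Variable Q : quiver.
Implicit Types (v : vertex Q) (a b : arrow Q) (s t : seq (arrow Q)).

Fixpoint walk v s : bool :=
  if s is a :: s' then (source a == v) && walk (target a) s' else true.

(* The starting vertex is needed to tell the trivial paths apart. *)
Record qpath := QPath {
  path_val : vertex Q * seq (arrow Q);
  path_valP : walk path_val.1 path_val.2
}.

HB.instance Definition _ := [isSub for path_val].
HB.instance Definition _ := [Choice of qpath by <:].

Implicit Types p q : qpath.

Definition path_source p : vertex Q := (path_val p).1.
Definition path_arrows p : seq (arrow Q) := (path_val p).2.
Definition path_vertices p : seq (vertex Q) :=
  path_source p :: map (@target Q) (path_arrows p).
Definition path_target p : vertex Q :=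
  last (path_source p) (map (@target Q) (path_arrows p)).
Definition path_length p : nat := size (path_arrows p).

Definition trivial_path v : qpath := @QPath (v, [::]) isT.

Lemma walk_arrow a : walk (source a) [:: a].
Proof. by rewrite /= eqxx. Qed.

Definition arrow_path a : qpath := @QPath (source a, [:: a]) (walk_arrow a).

Lemma walk_cat v s t :
  walk v (s ++ t) = walk v s && walk (last v (map (@target Q) s)) t.
Proof. by elim: s v => //= a s IHs v; rewrite IHs andbA. Qed.

Lemma path_catP p q :
  path_target p = path_source q ->
  walk (path_source p) (path_arrows p ++ path_arrows q).
Proof.
by move=> e; rewrite walk_cat -/(path_target p) e (path_valP p) (path_valP q).
Qed.

Definition path_join p q (e : path_target p = path_source q) : qpath :=
  @QPath (path_source p, path_arrows p ++ path_arrows q) (path_catP e).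

Definition path_cat p q : option qpath :=
  if path_target p =P path_source q is ReflectT e then Some (path_join e)
  else None.

Lemma path_catE p q (e : path_target p = path_source q) :
  path_cat p q = Some (path_join e).
Proof. by rewrite /path_cat; case: eqP => // e'; congr Some; apply: val_inj. Qed.

Lemma path_cat_None p q : path_target p <> path_source q -> path_cat p q = None.
Proof. by rewrite /path_cat; case: eqP. Qed.

Lemma path_catA p q r :
  obind (path_cat p) (path_cat q r) = obind (path_cat^~ r) (path_cat p q).
Proof.
have srcE p' q' (e : path_target p' = path_source q') :
    path_source (path_join e) = path_source p' by [].
have tgtE p' q' (e : path_target p' = path_source q') :
    path_target (path_join e) = path_target q'.
  by rewrite /path_target /path_source /path_arrows /= map_cat last_cat
     -/(path_source p') -/(path_arrows p') -/(path_target p') e.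
have [e1|/eqP n1] := eqVneq (path_target p) (path_source q);
have [e2|/eqP n2] := eqVneq (path_target q) (path_source r).
- rewrite (path_catE e1) (path_catE e2) /=.
  have f1 := etrans e1 (esym (srcE _ _ e2)); have f2 := etrans (tgtE _ _ e1) e2.
  by rewrite (path_catE f1) (path_catE f2); congr Some; apply: val_inj;
     rewrite /path_arrows /= catA.
- by rewrite (path_catE e1) (path_cat_None n2) /= path_cat_None // tgtE.
- by rewrite (path_catE e2) (path_cat_None n1) /= path_cat_None // srcE.
- by rewrite (path_cat_None n1) (path_cat_None n2).
Qed.

Lemma path_cat1p v p :
  path_cat (trivial_path v) p = if v == path_source p then Some p else None.
Proof.
case: eqP => [e|n]; last by rewrite path_cat_None.
have e' : path_target (trivial_path v) = path_source p by [].
rewrite (path_catE e'); congr Some; apply: val_inj => /=.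
by rewrite /path_arrows [path_source _]e; case: p {e e'} => -[].
Qed.

Lemma path_catp1 v p :
  path_cat p (trivial_path v) = if v == path_target p then Some p else None.
Proof.
case: eqP => [e|n]; last by rewrite path_cat_None // => /esym.
have e' : path_target p = path_source (trivial_path v) by [].
rewrite (path_catE e'); congr Some; apply: val_inj => /=.
by rewrite cats0; case: p {e e'} => -[].
Qed.

End Paths.

(* Finitely supported functions from the paths of [Q] to [k]. A quiver without
   vertices gives the zero ring, whence the [pzRingType] instance below. *)
Definition path_algebra (k : comNzRingType) (Q : quiver) : Type :=
  {malg k[qpath Q]}.

HB.instance Definition _ (k : comNzRingType) (Q : quiver) :=
  Choice.on (path_algebra k Q).

(* The operations are locked: otherwise failing unification problems unfold
   them down to finite maps and take minutes. *)
HB.lock Definition coef (k : comNzRingType) (Q : quiver)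
  (x : path_algebra k Q) (p : qpath Q) : k := mcoeff p x.

HB.lock Definition path_supp (k : comNzRingType) (Q : quiver)
  (x : path_algebra k Q) : {fset qpath Q} := msupp x.

HB.lock Definition of_path (k : comNzRingType) (Q : quiver)
  (p : qpath Q) : path_algebra k Q := mkmalgU p 1.

HB.lock Definition pa_zero (k : comNzRingType) (Q : quiver) :
  path_algebra k Q := (0 : {malg k[qpath Q]}).

HB.lock Definition pa_opp (k : comNzRingType) (Q : quiver)
  (x : path_algebra k Q) : path_algebra k Q := (- (x : {malg k[qpath Q]})).

HB.lock Definition pa_add (k : comNzRingType) (Q : quiver)
    (x y : path_algebra k Q) : path_algebra k Q :=
  (x : {malg k[qpath Q]}) + (y : {malg k[qpath Q]}).

HB.lock Definition pa_scale (k : comNzRingType) (Q : quiver) (c : k)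
    (x : path_algebra k Q) : path_algebra k Q :=
  c *: (x : {malg k[qpath Q]}).

Section PathModule.
Variables (k : comNzRingType) (Q : quiver).
Local Notation kQ := (path_algebra k Q).
Local Notation malgQ := {malg k[qpath Q]}.

Let pa_addA : associative (@pa_add k Q).
Proof. by move=> x y z; rewrite pa_add.unlock; apply: (@addrA malgQ). Qed.

Let pa_addC : commutative (@pa_add k Q).
Proof. by move=> x y; rewrite pa_add.unlock; apply: (@addrC malgQ). Qed.

Let pa_add0 : left_id (@pa_zero k Q) (@pa_add k Q).
Proof.
by move=> x; rewrite pa_add.unlock pa_zero.unlock; apply: (@add0r malgQ).
Qed.

Let pa_addN : left_inverse (@pa_zero k Q) (@pa_opp k Q) (@pa_add k Q).
Proof.
move=> x; rewrite pa_add.unlock pa_zero.unlock pa_opp.unlock.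
exact: (@addNr malgQ).
Qed.

HB.instance Definition _ :=
  GRing.isZmodule.Build kQ pa_addA pa_addC pa_add0 pa_addN.

Let pa_scaleA c d (x : kQ) : pa_scale c (pa_scale d x) = pa_scale (c * d) x.
Proof. by rewrite pa_scale.unlock; apply: (@scalerA k malgQ). Qed.

Let pa_scale1 : left_id 1 (@pa_scale k Q).
Proof. by move=> x; rewrite pa_scale.unlock; apply: (@scale1r k malgQ). Qed.

Let pa_scaleDr : right_distributive (@pa_scale k Q) +%R.
Proof.
move=> c x y; rewrite pa_scale.unlock.
by rewrite /GRing.add /= pa_add.unlock; apply: (@scalerDr k malgQ).
Qed.

Let pa_scaleDl (x : kQ) : {morph (@pa_scale k Q)^~ x : c d / c + d}.
Proof.
move=> c d; rewrite pa_scale.unlock.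
by rewrite [in RHS]/GRing.add /= pa_add.unlock; apply: (@scalerDl k malgQ).
Qed.

HB.instance Definition _ := GRing.Zmodule_isLmodule.Build k kQ
  pa_scaleA pa_scale1 pa_scaleDr pa_scaleDl.

Lemma coefP (x y : kQ) : (forall p, coef x p = coef y p) <-> x = y.
Proof. by rewrite coef.unlock; apply: malgP. Qed.

Lemma coef0 p : coef (0 : kQ) p = 0.
Proof. by rewrite -[X in coef X p]/(pa_zero k Q) coef.unlock pa_zero.unlock; apply: mcoeff0. Qed.

Lemma coefD (x y : kQ) p : coef (x + y) p = coef x p + coef y p.
Proof.
by rewrite -[X in coef X p]/(pa_add x y) coef.unlock pa_add.unlock; apply: mcoeffD.
Qed.

Lemma coefZ c (x : kQ) p : coef (c *: x) p = c * coef x p.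
Proof.
by rewrite -[X in coef X p]/(pa_scale c x) coef.unlock pa_scale.unlock; apply: mcoeffZ.
Qed.

Lemma coef_of_path (p q : qpath Q) : coef (of_path k p) q = (p == q)%:R.
Proof. by rewrite coef.unlock of_path.unlock; apply: mcoeffU. Qed.

Lemma mem_path_supp (x : kQ) p : (p \in path_supp x) = (coef x p != 0).
Proof. by rewrite coef.unlock path_supp.unlock mcoeff_neq0. Qed.

Lemma coef_sum I (r : seq I) (F : I -> kQ) p :
  coef (\sum_(i <- r) F i) p = \sum_(i <- r) coef (F i) p.
Proof. exact: (big_morph (fun x : kQ => coef x p) (fun x y => coefD x y p) (coef0 p)). Qed.

Lemma path_algebraE (x : kQ) : x = \sum_(p <- path_supp x) coef x p *: of_path k p.
Proof.
apply/coefP => q; rewrite coef_sum.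
have [qx|qx] := boolP (q \in path_supp x).
  rewrite (big_fsetD1 q) //= coefZ coef_of_path eqxx mulr1 big1_fset ?addr0 //.
  by move=> p; rewrite !inE coefZ coef_of_path => /andP[/negPf->]; rewrite mulr0.
rewrite big1_fset => [|p px _].
  by apply/eqP; rewrite -[_ == _]negbK -mem_path_supp.
rewrite coefZ coef_of_path; case: eqP => [e|]; rewrite ?mulr0 //.
by rewrite -e px in qx.
Qed.

End PathModule.

Definition of_path_cat (k : comNzRingType) (Q : quiver) (p q : qpath Q) :
    path_algebra k Q :=
  if path_cat p q is Some r then of_path k r else 0.

HB.lock Definition pa_mul (k : comNzRingType) (Q : quiver)
    (x y : path_algebra k Q) : path_algebra k Q :=
  \sum_(p <- path_supp x) \sum_(q <- path_supp y)
     (coef x p * coef y q) *: of_path_cat k p q.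

Section PathAlgebra.
Variables (k : comNzRingType) (Q : quiver).
Local Notation kQ := (path_algebra k Q).
Local Notation of_path := (@of_path k Q).
Local Notation of_path_cat := (@of_path_cat k Q).
Local Notation pa_mul := (@pa_mul k Q).

Definition pa_one : kQ := \sum_(v : vertex Q) of_path (trivial_path v).

Let lin (V : lmodType k) (h : qpath Q -> V) (x : kQ) : V :=
  \sum_(p <- path_supp x) coef x p *: h p.

Let linEw (V : lmodType k) (h : qpath Q -> V) (d : {fset qpath Q}) (x : kQ) :
  (path_supp x `<=` d)%fset -> lin h x = \sum_(p <- d) coef x p *: h p.
Proof.
move=> le; rewrite /lin; apply/esym.
rewrite -(big_fset_incl _ le) //= => p _.
by rewrite mem_path_supp negbK => /eqP->; rewrite scale0r.
Qed.

Let lin_is_linear (V : lmodType k) (h : qpath Q -> V) c x y :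
  lin h (c *: x + y) = c *: lin h x + lin h y.
Proof.
pose d := (path_supp x `|` path_supp y `|` path_supp (c *: x + y)%R)%fset.
rewrite (@linEw _ _ d x) ?(@linEw _ _ d y) ?(@linEw _ _ d (c *: x + y)).
- rewrite scaler_sumr -big_split /=; apply: eq_bigr => p _.
  by rewrite coefD coefZ scalerDl scalerA.
- by rewrite fsubsetUr.
- by rewrite /d fsetUAC fsubsetUr.
- by rewrite /d -fsetUA fsubsetUl.
Qed.

Let linU (V : lmodType k) (h : qpath Q -> V) p : lin h (of_path p) = h p.
Proof.
rewrite (@linEw _ _ [fset p]%fset); last first.
  apply/fsubsetP => q; rewrite mem_path_supp coef_of_path inE [q == p]eq_sym.
  by case: (p == q); rewrite ?oner_eq0 ?eqxx.
by rewrite big_seq_fset1 coef_of_path eqxx scale1r.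
Qed.

Let lin_ext (V : lmodType k) (f g : kQ -> V) :
  (forall c x y, f (c *: x + y) = c *: f x + f y) ->
  (forall c x y, g (c *: x + y) = c *: g x + g y) ->
  (forall p, f (of_path p) = g (of_path p)) -> f =1 g.
Proof.
move=> lf lg e x.
have z (h : kQ -> V) : (forall c x y, h (c *: x + y) = c *: h x + h y) -> h 0 = 0.
  by move=> lh; have := lh (-1) 0 0; rewrite scaler0 addr0 scaleN1r addNr.
rewrite (path_algebraE x); elim: (path_supp x : seq _) => [|p s IHs].
  by rewrite big_nil !z.
by rewrite big_cons lf lg e IHs.
Qed.

Let pa_mulE x y : pa_mul x y = lin (fun p => lin (of_path_cat p) y) x.
Proof.
rewrite pa_mul.unlock; apply: eq_bigr => p _; rewrite scaler_sumr; apply: eq_bigr => q _.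
by rewrite scalerA.
Qed.

Let mulLl c x y z : pa_mul (c *: x + y) z = c *: pa_mul x z + pa_mul y z.
Proof. by rewrite !pa_mulE lin_is_linear. Qed.

Let mulLr c x y z : pa_mul z (c *: x + y) = c *: pa_mul z x + pa_mul z y.
Proof.
rewrite !pa_mulE scaler_sumr -big_split /=; apply: eq_bigr => p _.
by rewrite lin_is_linear scalerDr !scalerA mulrC.
Qed.

Let pa_mulUU p q : pa_mul (of_path p) (of_path q) = of_path_cat p q.
Proof. by rewrite pa_mulE !linU. Qed.

Let pa_mul0 x : pa_mul x 0 = 0.
Proof. by have := mulLr (-1) 0 0 x; rewrite scaler0 addr0 scaleN1r addNr. Qed.

Let pa_0mul x : pa_mul 0 x = 0.
Proof. by have := mulLl (-1) 0 0 x; rewrite scaler0 addr0 scaleN1r addNr. Qed.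

Fact pa_mulA : associative pa_mul.
Proof.
move=> x y z.
apply: (@lin_ext kQ (fun x => pa_mul x (pa_mul y z))
                    (fun x => pa_mul (pa_mul x y) z)) => [c u v|c u v|p] /=.
- exact: mulLl.
- by rewrite !mulLl.
apply: (@lin_ext kQ (fun y => pa_mul (of_path p) (pa_mul y z))
                    (fun y => pa_mul (pa_mul (of_path p) y) z)) => [c u v|c u v|q] /=.
- by rewrite mulLl mulLr.
- by rewrite mulLr mulLl.
apply: (@lin_ext kQ (fun z => pa_mul (of_path p) (pa_mul (of_path q) z))
                    (pa_mul (pa_mul (of_path p) (of_path q)))) => [c u v|c u v|r] /=.
- by rewrite !mulLr.
- by rewrite mulLr.
rewrite !pa_mulUU /of_path_cat; have := path_catA p q r.
case: (path_cat q r) (path_cat p q) => [s|] [t|] /=; rewrite ?pa_mulUU /of_path_cat.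
- by move=> ->.
- by move=> ->; rewrite pa_0mul.
- by move=> <-; rewrite pa_mul0.
- by rewrite pa_mul0 pa_0mul.
Qed.

Let pa_mulDl : left_distributive pa_mul +%R.
Proof. by move=> x y z; have := mulLl 1 x y z; rewrite !scale1r. Qed.

Let pa_mulDr : right_distributive pa_mul +%R.
Proof. by move=> z x y; have := mulLr 1 x y z; rewrite !scale1r. Qed.

Let pa_mul1 : left_id pa_one pa_mul.
Proof.
apply: (@lin_ext kQ (pa_mul pa_one) id) => [c x y|//|p]; first exact: mulLr.
have -> : pa_mul pa_one (of_path p) =
          \sum_v pa_mul (of_path (trivial_path v)) (of_path p).
  exact: (big_morph (pa_mul^~ (of_path p)) (fun x y => pa_mulDl x y _) (pa_0mul _)).
rewrite (bigD1 (path_source p)) //= big1 => [|v /negPf nv].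
  by rewrite pa_mulUU /of_path_cat path_cat1p eqxx addr0.
by rewrite pa_mulUU /of_path_cat path_cat1p nv.
Qed.

Let pa_1mul : right_id pa_one pa_mul.
Proof.
apply: (@lin_ext kQ (pa_mul^~ pa_one) id) => [c x y|//|p]; first exact: mulLl.
have -> : pa_mul (of_path p) pa_one =
          \sum_v pa_mul (of_path p) (of_path (trivial_path v)).
  exact: (big_morph (pa_mul (of_path p)) (pa_mulDr _) (pa_mul0 _)).
rewrite (bigD1 (path_target p)) //= big1 => [|v /negPf nv].
  by rewrite pa_mulUU /of_path_cat path_catp1 eqxx addr0.
by rewrite pa_mulUU /of_path_cat path_catp1 nv.
Qed.

HB.instance Definition _ := GRing.Zmodule_isPzRing.Build kQ
  pa_mulA pa_mul1 pa_1mul pa_mulDl pa_mulDr.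

Lemma pa_scalerAl (c : k) (x y : kQ) : c *: (x * y) = (c *: x) * y.
Proof. by have := mulLl c x 0 y; rewrite pa_0mul !addr0. Qed.

Lemma pa_scalerAr (c : k) (x y : kQ) : c *: (x * y) = x * (c *: y).
Proof. by have := mulLr c y 0 x; rewrite pa_mul0 !addr0. Qed.

Lemma of_pathM (p q : qpath Q) : of_path p * of_path q = of_path_cat p q.
Proof. exact: pa_mulUU. Qed.

Definition of_arrow (a : arrow Q) : kQ := of_path (arrow_path a).

End PathAlgebra.

Arguments of_path k {Q} p.
Arguments of_arrow k {Q} a.

(* [relation a b] says that the path [a b] is one of the chosen generators of
   the ideal [I]. *)
Record bound_quiver := BoundQuiver {
  quiver_of :> quiver;
  relation : rel (arrow quiver_of);
  relation_path : forall a b, relation a b -> target a = source b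
}.

Section Gentle.
Variables (k : fieldType) (Q : bound_quiver).
Local Notation kQ := (path_algebra k Q).

Definition in_ideal (x : kQ) : Prop :=
  exists2 s : seq (kQ * (arrow Q * arrow Q) * kQ),
    all (fun t => relation t.1.2.1 t.1.2.2) s &
    x = \sum_(t <- s) t.1.1 * (of_arrow k t.1.2.1 * of_arrow k t.1.2.2) * t.2.

Definition is_path2 (a b : arrow Q) : Prop := target a = source b.
Definition path2_in (a b : arrow Q) : Prop :=
  is_path2 a b /\ in_ideal (of_arrow k a * of_arrow k b).
Definition path2_notin (a b : arrow Q) : Prop :=
  is_path2 a b /\ ~ in_ideal (of_arrow k a * of_arrow k b).

Let has_rel (s : seq (arrow Q)) : Prop :=
  exists s1 a b s2, s = s1 ++ [:: a, b & s2] /\ relation a b.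

Let supported (x : kQ) : Prop :=
  forall p, coef x p != 0 -> has_rel (path_arrows p).

Let supported_sum I (r : seq I) (P : pred I) (F : I -> kQ) :
  (forall i, P i -> supported (F i)) -> supported (\sum_(i <- r | P i) F i).
Proof.
move=> sF; elim/big_ind: _ => // [p|x y sx sy p]; first by rewrite coef0 eqxx.
rewrite coefD; have [->|/sx//] := eqVneq (coef x p) 0.
by rewrite add0r => /sy.
Qed.

Let supportedZ c x : supported x -> supported (c *: x).
Proof. by move=> sx p; rewrite coefZ mulf_eq0 negb_or => /andP[_ /sx]. Qed.

Lemma of_arrowM a b : is_path2 a b ->
  exists2 r : qpath Q, path_arrows r = [:: a; b] &
    of_arrow k a * of_arrow k b = of_path k r.
Proof.
move=> ab; rewrite /of_arrow of_pathM /of_path_cat.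
have e : path_target (arrow_path a) = path_source (arrow_path b) by [].
by rewrite (path_catE e); exists (path_join e).
Qed.

Lemma coef_of_path_cat (p q r : qpath Q) : coef (of_path_cat k p q) r != 0 ->
  path_arrows r = path_arrows p ++ path_arrows q.
Proof.
rewrite /of_path_cat; have [e|/eqP n] := eqVneq (path_target p) (path_source q).
  rewrite (path_catE e) coef_of_path.
  by have [<-|_] := path_join e =P r; rewrite ?eqxx.
by rewrite path_cat_None // coef0 eqxx.
Qed.

Let supported_generator x y a b : relation a b ->
  supported (x * (of_arrow k a * of_arrow k b) * y).
Proof.
move=> ab; have [r ra ->] := of_arrowM (relation_path ab).
rewrite (path_algebraE x) mulr_suml mulr_suml; apply: supported_sum => p _.
rewrite -pa_scalerAl -pa_scalerAl; apply: supportedZ.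
rewrite (path_algebraE y) mulr_sumr; apply: supported_sum => q _.
rewrite -pa_scalerAr; apply: supportedZ; rewrite of_pathM /of_path_cat.
have [e|/eqP n] := eqVneq (path_target p) (path_source r); last first.
  by rewrite path_cat_None // mul0r => t; rewrite coef0 eqxx.
rewrite (path_catE e) of_pathM => t /coef_of_path_cat->.
rewrite /path_arrows /= -!/(path_arrows _) ra.
by exists (path_arrows p), a, b, (path_arrows q); rewrite -catA.
Qed.

Lemma in_ideal_path2 a b : is_path2 a b ->
  in_ideal (of_arrow k a * of_arrow k b) <-> relation a b.
Proof.
move=> pab; split=> [[s /allP rel_s e]|rab]; last first.
  exists [:: (1, (a, b), 1)]; first by rewrite /= rab.
  by rewrite big_seq1 /= mul1r mulr1.
have [r ra er] := of_arrowM pab; rewrite er in e.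
have : supported (of_path k r).
  rewrite e big_seq; apply: supported_sum => t /rel_s; exact: supported_generator.
move=> /(_ r); rewrite coef_of_path eqxx oner_eq0 ra => /(_ isT).
case=> [[|c [|d [|? ?]]]] [a' [b' [s2]]] [] //=.
by case=> -> -> _.
Qed.

Definition at_most_one T (P : T -> Prop) : Prop :=
  forall x y, P x -> P y -> x = y.

Definition locally_gentle : Prop :=
  [/\ forall v : vertex Q, (#|[set a : arrow Q | target a == v]| <= 2)%N
                        /\ (#|[set a : arrow Q | source a == v]| <= 2)%N,
      forall a, at_most_one (fun b => path2_in a b)
             /\ at_most_one (fun c => path2_in c a)
    & forall a, at_most_one (fun b => path2_notin a b)
             /\ at_most_one (fun c => path2_notin c a)].

Definition quotient_findim : Prop :=
  exists s : seq kQ, forall x : kQ, exists c : 'I_(size s) -> k,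
    in_ideal (x - \sum_i c i *: s`_i).

Definition gentle : Prop := locally_gentle /\ quotient_findim.

Definition maximal_path (p : qpath Q) : Prop :=
  ~ in_ideal (of_path k p) /\
  forall a, in_ideal (of_path k p * of_arrow k a)
         /\ in_ideal (of_arrow k a * of_path k p).

Definition associated_perm (p : qpath Q) n (al : 'S_n) : Prop :=
  let v (i : 'I_n) := nth (path_source p) (path_vertices p) i in
  (path_length p).+1 = n /\
  forall i, (forall j, j != i -> v j = v i -> al i = j)
         /\ ((forall j, j != i -> v j <> v i) -> al i = i).

Definition gentle_one_maximal_path n (al : 'S_n) : Prop :=
  gentle /\
  exists2 p, (forall q, maximal_path q <-> q = p) & associated_perm p al.

(* [A] is isomorphic to [kQ/I]. *)
Definition presents (A : algType k) : Prop :=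
  exists f : {rmorphism kQ -> A},
    [/\ scalable f, forall y, exists x, f x = y
      & forall x, f x = 0 <-> in_ideal x].

End Gentle.

Definition has_quasi_diagram (k : fieldType) (A : algType k) n (al : 'S_n) :
    Prop :=
  exists Q : bound_quiver, gentle_one_maximal_path k Q al /\ presents Q A.

Definition opposite (Q : quiver) : quiver :=
  @Quiver (vertex Q) (arrow Q) (@target Q) (@source Q).

(* By [in_ideal_path2], a path of length two lies in the ideal exactly when it
   is one of the generators. *)
Definition dual_relation (Q : bound_quiver) : rel (arrow (opposite Q)) :=
  fun b a : arrow Q => (target a == source b) && ~~ relation a b.

Lemma dual_relation_path (Q : bound_quiver) (b a : arrow (opposite Q)) :
  dual_relation b a -> target b = source a.
Proof. by case/andP => /eqP. Qed.

Definition koszul_dual (Q : bound_quiver) : bound_quiver :=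
  BoundQuiver (@dual_relation_path Q).

(* The Koszul dual quasi-diagram of [al] exists and is equal to [be]. *)
Definition is_koszul_dual (k : fieldType) n (al : 'S_n) n' (be : 'S_n') :
    Prop :=
  exists Q : bound_quiver,
    gentle_one_maximal_path k Q al
    /\ gentle_one_maximal_path k (koszul_dual Q) be.

(* Global dimension is defined with left modules; for a finite-dimensional
   algebra the left and right global dimensions agree. *)
Section GlobalDimension.
Variable A : nzRingType.

Definition projective (P : lmodType A) : Prop :=
  forall (U V : lmodType A) (g : {linear U -> V}) (f : {linear P -> V}),
    (forall y, exists x, g x = y) ->
    exists h : {linear P -> U}, forall x, g (h x) = f x.

(* [M] has a projective resolution 0 -> P_d -> ... -> P_0 -> M -> 0; it is
   indexed by all of [nat] and vanishes beyond [d]. *)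
Definition projdim_le (M : lmodType A) (d : nat) : Prop :=
  exists (P : nat -> lmodType A) (del : forall i, {linear P i.+1 -> P i})
         (eps : {linear P 0 -> M}),
    [/\ forall i, projective (P i),
        forall i, (d < i)%N -> forall x : P i, x = 0,
        forall y, exists x, eps x = y,
        forall x, eps x = 0 <-> exists y, del 0 y = x
      & forall i x, del i x = 0 <-> exists y, del i.+1 y = x].

Definition gldim_le (d : nat) : Prop := forall M : lmodType A, projdim_le M d.

Definition gldim_eq (d : nat) : Prop :=
  gldim_le d /\ forall d', gldim_le d' -> (d <= d')%N.

End GlobalDimension.

(* Main.v *)
Require Import Defs.
From HB Require Import structures.
From mathcomp Require Import all_boot all_order all_fingroup all_algebra.
From mathcomp Require Import finmap generic_quotient ring_quotient boolp.
From mathcomp Require classical_sets.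

Set Implicit Arguments.
Unset Strict Implicit.
Unset Printing Implicit Defensive.

Import GRing.Theory.

Local Open Scope ring_scope.

(** Number the points from 0 to n - 1, where n = 2m, and let tau map i to
    zeta^-1 (al i).

    Combinatorics. Up to conjugacy tau is the inverse of zeta al, so al is maximal
    exactly when tau is a single cycle ([maximal_syzygy_perm]). A chord diagram
    has no isolated points, hence it is regular exactly when every orbit of
    zeta al contains 0, that is when there is only one orbit. Rotating al
    conjugates zeta al, which settles the conditions on rotations. As zeta and
    zeta al are then both cycles of length n, al is an even permutation; it is a
    product of m transpositions, so m is even ([maximal_even]).

    Koszul dual. Let p be the maximal path, with vertices v_0, ..., v_(n-1) and
    arrows a_i from v_i to v_(i+1). Having one maximal path means that the
    nonzero paths are the pieces of p ([one_maximal_pathP]), so a path a_j a_i of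
    length two is zero exactly when j + 1 = al i. Hence, in the dual, the arrow
    a_i can only be followed by a_(tau i), and by nothing when al i = 0
    ([follows_dual]). The nonzero paths of the dual therefore run along the
    orbits of tau. If one of them contains all the others, then tau is a single
    cycle ([dual_dominated_maximal]); conversely the orbit of n - 1 under a
    cyclic tau is a path through all the arrows, and the quasi-diagram of the
    dual is conjugate to al ([maximal_dual]). Since dualizing twice gives back
    the bound quiver ([koszul_dualK]), both statements about duals follow.

    Global dimension. The coefficients along the pieces of p identify A with the
    upper triangular matrices X such that X_(i,i) = X_(al i, al i)
    ([triangular_presentation]). Let U_j be the module of the columns that vanish
    from row j on. The projective module at the vertex of i maps onto U_(i+1)
    with kernel U_(al i) ([short_exact_Umod]), so the syzygy of U_(i+1) is
    U_(tau i + 1), as long as al i is not 0; and U_(i+1) is projective exactly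
    when al i = 0. If the global dimension is finite, then every orbit of tau
    reaches a zero of al, which means that it contains n - 1, so that tau is a
    cycle. If tau is a cycle, then U_n has projective dimension n - 1 and the
    other U_j have a smaller one. Every module is filtered by modules on which A
    acts through a diagonal entry, and the syzygies of these are sums of two U_j
    with j < n, tensored with a vector space ([short_exact_diagonal]); so n - 1
    is the global dimension. *)

(** * Orbits of a chord diagram composed with the rotation *)

Section OnePorbit.
Variable T : finType.
Implicit Types s t : {perm T}.

Definition one_porbit s : Prop := forall x y, y \in porbit s x.

Lemma card_porbits1 (x0 : T) s : #|porbits s| = 1%N <-> one_porbit s.
Proof.
split=> [/eqP/cards1P[O eO] x y|h].
  have orbO z : porbit s z = O.
    by apply/set1P; rewrite -eO; apply: imset_f.
  by rewrite -eq_porbit_mem !orbO.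
apply/eqP/cards1P; exists (porbit s x0); apply/setP => O; rewrite inE.
apply/imsetP/eqP => [[x _ ->]|->]; last by exists x0.
by apply/eqP; rewrite eq_porbit_mem.
Qed.

Lemma one_porbitJ s t : one_porbit s -> one_porbit (s ^ t)%g.
Proof.
move=> h x y; have /porbitP[i e] := h (t^-1%g x) (t^-1%g y).
by apply/porbitP; exists i; rewrite -conjXg -[x](permKV t) permJ -e permKV.
Qed.

Lemma one_porbitV s : one_porbit s -> one_porbit s^-1%g.
Proof. by move=> h x y; rewrite porbitV. Qed.

Lemma card_porbit_full s x : one_porbit s -> #|porbit s x| = #|T|.
Proof. by move=> h; apply: eq_card => y; rewrite h. Qed.

(** A permutation with a single orbit runs through it without repetition. *)
Lemma one_porbit_period s x i : one_porbit s -> (0 < i)%N -> iter i s x = x ->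
  (#|T| <= i)%N.
Proof.
move=> h i0 e; rewrite leqNgt; apply/negP => iT.
have := uniq_traject_porbit s x; rewrite (card_porbit_full _ h) => u.
have T0 : (0 < #|T|)%N by exact: leq_ltn_trans iT.
have := nth_uniq x _ _ u; rewrite size_traject => /(_ i 0%N iT T0).
by rewrite !nth_traject // e eqxx => /esym/eqP i00; rewrite i00 in i0.
Qed.

Lemma porbits_partition s : partition (porbits s) [set: T].
Proof.
apply/and3P; split.
- apply/eqP/setP => x; rewrite inE; apply/bigcupP.
  by exists (porbit s x); [exact: imset_f|exact: porbit_id].
- apply/trivIsetP => A B /imsetP[x _ ->] /imsetP[y _ ->] nAB.
  rewrite -setI_eq0; apply: contraT => /set0Pn[z]; rewrite inE -!eq_porbit_mem.
  by move=> /andP[/eqP zx /eqP zy]; case/eqP: nAB; rewrite -zx zy.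
- apply/imsetP => -[x _ e].
  by have := porbit_id s x; rewrite -e inE.
Qed.

(** The orbits are pairs, so there are [m] of them; parity is read off the number
    of orbits. *)
Lemma odd_involution s m : (forall x, s (s x) = x) -> (forall x, s x <> x) ->
  #|T| = (2 * m)%N -> odd_perm s = odd m.
Proof.
move=> sK sneq cT.
have c2 : {in porbits s, forall O : {set T}, #|O| = 2%N}.
  move=> _ /imsetP[x _ ->].
  have -> : porbit s x = [set x; s x].
    apply/setP => y; rewrite !inE; apply/porbitP/orP => [[i ->]|].
      rewrite permX; elim: i => [|i [/eqP e|/eqP e]] /=; first by left.
        by right; rewrite e.
      by left; rewrite e sK.
    by case=> /eqP->; [exists 0%N; rewrite expg0 perm1|exists 1%N; rewrite expg1].
  by rewrite cards2 eq_sym; case: eqP => // /sneq.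
have := card_uniform_partition c2 (porbits_partition s).
rewrite cardsT cT mulnC => /eqP; rewrite eqn_pmul2r // => /eqP e.
by rewrite /odd_perm cT mul2n odd_double /= -e.
Qed.

End OnePorbit.

Section Rotations.
Variable n : nat.
Implicit Types al : 'S_n.

Lemma zetaE (i : 'I_n) : (i.+1 < n)%N -> zeta n i = i.+1 :> nat.
Proof. by move=> lt; rewrite permE /= modn_small. Qed.

Lemma zeta_last (i : 'I_n) : i.+1 = n -> zeta n i = 0%N :> nat.
Proof. by move=> e; rewrite permE /= e modnn. Qed.

Lemma zetaVE (j : 'I_n) : (0 < j)%N -> ((zeta n)^-1%g j).+1 = j.
Proof.
move=> j0; set i := (zeta n)^-1%g j.
have ij : zeta n i = j by rewrite /i permKV.
have := ltn_ord i; rewrite leq_eqVlt => /orP[/eqP e|lt].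
  by have := zeta_last e; rewrite ij => j00; rewrite j00 in j0.
by rewrite -(zetaE lt) ij.
Qed.

Lemma zetaV0 (j : 'I_n) : j = 0%N :> nat -> ((zeta n)^-1%g j).+1 = n.
Proof.
move=> j0; set i := (zeta n)^-1%g j.
have ij : zeta n i = j by rewrite /i permKV.
have := ltn_ord i; rewrite leq_eqVlt => /orP[/eqP //|lt].
by have := zetaE lt; rewrite ij j0.
Qed.

Lemma one_porbit_zeta : one_porbit (zeta n).
Proof.
have from0 (x y : 'I_n) : x = 0%N :> nat -> y \in porbit (zeta n) x.
  move=> x0; apply/porbitP; exists y; apply: val_inj; rewrite permX /=.
  have gen i : (i < n)%N -> iter i (zeta n) x = i :> nat.
    elim: i => [|i IH] lt //=.
    by rewrite zetaE (IH (ltnW lt)).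
  by rewrite gen.
move=> x y; pose z : 'I_n := Ordinal (leq_ltn_trans (leq0n x) (ltn_ord x)).
have /eqP <- : porbit (zeta n) z == porbit (zeta n) x.
  by rewrite eq_porbit_mem porbit_sym from0.
exact: from0.
Qed.

Lemma zeta_powN l : zeta_pow n (- l) = ((zeta_pow n l)^-1)%g.
Proof. by case: l => [[|j]|j] //=; rewrite ?expg0 ?invg1 ?invgK. Qed.

Lemma rotationE l al : rotation l al = (al ^ zeta_pow n l)%g.
Proof. by rewrite /rotation /Defs.pcomp zeta_powN conjgE mulgA. Qed.

Lemma zeta_rotation l al :
  Defs.pcomp (zeta n) (rotation l al) = (Defs.pcomp (zeta n) al ^ zeta_pow n l)%g.
Proof.
rewrite rotationE /Defs.pcomp conjMg; congr (_ * _)%g; rewrite [RHS]conjgE.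
suff -> : (zeta n * zeta_pow n l = zeta_pow n l * zeta n)%g by rewrite mulKg.
case: l => j /=; first by rewrite -expgS expgSr.
by apply: commuteV; apply: commuteX.
Qed.

Lemma maximalP (x0 : 'I_n) al : maximal al <-> one_porbit (Defs.pcomp (zeta n) al).
Proof. exact: card_porbits1. Qed.

Lemma maximal_rotation l al : maximal al -> maximal (rotation l al).
Proof.
have [n0|] := posnP n; last first.
  move=> n0; have x0 := Ordinal n0.
  by move=> /(maximalP x0) h; apply/(maximalP x0); rewrite zeta_rotation; apply: one_porbitJ.
rewrite /maximal => /eqP/cards1P[O eO].
have /imsetP[x _ _] : O \in porbits (Defs.pcomp (zeta n) al) by rewrite eO inE.
by case: x => x; rewrite [X in (_ < X)%N]n0.
Qed.

Lemma chord_rotation l al : chord_diagram al -> chord_diagram (rotation l al).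
Proof.
move=> [alK al_neq]; rewrite rotationE; set z := zeta_pow n l.
split=> i; rewrite -[i](permKV z) /isolated !permJ; first by rewrite alK.
by move/perm_inj; apply: al_neq.
Qed.

Lemma maximal_regular al : maximal al -> regular al.
Proof.
move=> h O /imsetP[x _ ->].
pose x0 : 'I_n := Ordinal (leq_ltn_trans (leq0n x) (ltn_ord x)).
by exists x0; [apply: (maximalP x0 al).1|left].
Qed.

Lemma regular_maximal (x0 : 'I_n) al : chord_diagram al -> regular al -> maximal al.
Proof.
move=> [_ al_neq] h; apply/(maximalP x0) => x y.
have to0 z : exists2 i : 'I_n, i \in porbit (Defs.pcomp (zeta n) al) z & i = 0%N :> nat.
  have /h[i iz [i0|/al_neq//]] : porbit (Defs.pcomp (zeta n) al) z \in
      porbits (Defs.pcomp (zeta n) al) by exact: imset_f.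
  by exists i.
have [i ix i0] := to0 x; have [j jy j0] := to0 y.
have ij : i = j by apply: val_inj; rewrite /= i0 j0.
rewrite -ij in jy; rewrite -eq_porbit_mem.
by move: ix jy; rewrite -!eq_porbit_mem => /eqP <- /eqP <-.
Qed.

(** Both [zeta n] and [zeta n] after [al] are cycles on all the points, so they have
    the same sign and [al] is even. *)
Lemma maximal_even m al : n = (2 * m)%N -> chord_diagram al -> maximal al -> ~~ odd m.
Proof.
move=> nE [alK al_neq] al_max.
have : odd_perm (Defs.pcomp (zeta n) al) = odd_perm (zeta n).
  rewrite /odd_perm al_max.
  have [n0|n0] := posnP n.
    move/eqP/cards1P: al_max => [O eO].
    have /imsetP[x _ _] : O \in porbits (Defs.pcomp (zeta n) al) by rewrite eO inE.
    by case: x => x; rewrite [X in (_ < X)%N]n0.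
  by have /(card_porbits1 (Ordinal n0))-> := one_porbit_zeta.
rewrite /Defs.pcomp odd_permM (odd_involution alK al_neq (m := m)) ?card_ord //.
by case: (odd m); case: (odd_perm _).
Qed.

(** On a gentle algebra this permutation lists at once the successive syzygies of
    the modules [Umod] below and the arrows of the nonzero paths of the dual. *)
Definition syzygy_perm al : 'S_n := (al * (zeta n)^-1)%g.

Lemma syzygy_permS al i : (0 < al i)%N -> (syzygy_perm al i).+1 = al i.
Proof. by move=> h; rewrite permM zetaVE. Qed.

Lemma syzygy_perm0 al i : al i = 0%N :> nat -> (syzygy_perm al i).+1 = n.
Proof. by move=> h; rewrite permM zetaV0. Qed.

Lemma syzygy_perm_last al i : (syzygy_perm al i).+1 = n -> al i = 0%N :> nat.
Proof.
move=> e; have [//|/syzygy_permS e'] := posnP (al i).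
by have := ltn_ord (al i); rewrite -e' e ltnn.
Qed.

(** Conjugating by the involution [al] turns the inverse of [zeta n] after [al] into
    [syzygy_perm al]. *)
Lemma maximal_syzygy_perm (x0 : 'I_n) al : quasi_diagram al ->
  maximal al <-> one_porbit (syzygy_perm al).
Proof.
move=> alK; have alV : (al^-1 = al)%g.
  by apply/permP => i; apply: (@perm_inj _ al); rewrite permKV alK.
have e : syzygy_perm al = ((Defs.pcomp (zeta n) al)^-1 ^ al)%g.
  by rewrite /syzygy_perm /Defs.pcomp invMg conjgE !mulgA mulgKV alV.
rewrite (maximalP x0); split=> h; first by rewrite e; apply/one_porbitJ/one_porbitV.
have -> : Defs.pcomp (zeta n) al = ((syzygy_perm al) ^ al)^-1%g.
  have alal : (al * al = 1)%g by rewrite -{1}alV mulVg.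
  by rewrite e -conjgM alal conjg1 invgK.
exact/one_porbitV/one_porbitJ.
Qed.

End Rotations.

(** * Submodules and quotient modules *)

Section Modules.
Variable A : nzRingType.
Implicit Types M N P K : lmodType A.

Definition lin_map M N (f : M -> N) (hf : linear f) : {linear M -> N} :=
  HB.pack f (GRing.isLinear.Build A M N *:%R f hf).

Definition submodule_of M (S : M -> Prop) : Prop :=
  S 0 /\ forall a x y, S x -> S y -> S (a *: x + y).

Section Submodule.
Variables (M : lmodType A) (S : M -> Prop) (hS : submodule_of S).

Definition sub_pred (h : submodule_of S) : M -> bool := fun x => `[< S x >].

Fact sub_pred_closed : GRing.subsemimod_closed (sub_pred hS).
Proof.
split; first split; first by apply/asboolP; case: hS.
  by move=> x y /asboolP Sx /asboolP Sy; apply/asboolP; rewrite -[x]scale1r; apply: hS.2.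
move=> a x /asboolP Sx; apply/asboolP; rewrite -[_ *: _]addr0.
by apply: hS.2 => //; case: hS.
Qed.

HB.instance Definition _ := GRing.isSubmodClosed.Build A M (sub_pred hS) sub_pred_closed.

Record submod (h : submodule_of S) :=
  Submod {submod_val :> M; submod_valP : submod_val \in sub_pred h}.

HB.instance Definition _ := [isSub for @submod_val hS].
HB.instance Definition _ := [Choice of submod hS by <:].
HB.instance Definition _ := [SubChoice_isSubLmodule of submod hS by <:].

Definition sub_incl : {linear submod hS -> M} := val.

Lemma sub_inclP (x : submod hS) : S (sub_incl x).
Proof. by case: x => x /= /asboolP. Qed.

Lemma sub_incl_inj : injective sub_incl.
Proof. exact: val_inj. Qed.

Lemma sub_lift x : S x -> exists y, sub_incl y = x.
Proof. by move=> /asboolP Sx; exists (@Submod hS x Sx). Qed.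

Lemma sub_factor N (f : {linear N -> M}) : (forall x, S (f x)) ->
  exists g : {linear N -> submod hS}, forall x, sub_incl (g x) = f x.
Proof.
move=> Sf; have Sf' x : f x \in sub_pred hS by apply/asboolP.
have hg : linear (fun x => Submod (Sf' x)).
  by move=> a x y; apply: sub_incl_inj; rewrite [in RHS]linearP /= linearP.
by exists (lin_map hg).
Qed.

End Submodule.

Lemma kernel_submodule M N (f : {linear M -> N}) :
  submodule_of (fun x => f x = 0).
Proof. by split=> [|a x y fx fy]; rewrite ?linear0 ?linearP ?fx ?fy ?scaler0 ?addr0. Qed.

Section QuotientModule.
Variables (M : lmodType A) (S : M -> Prop) (hS : submodule_of S).

Definition quomod := Quotient.quot (GRing.ZmodClosed.clone M (sub_pred hS) _).
HB.instance Definition _ := GRing.Zmodule.on quomod.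

Definition quo_pi (x : M) : quomod := (\pi_quomod x)%qT.

Lemma quo_piK (q : quomod) : exists x, quo_pi x = q.
Proof. by exists (repr q); rewrite /quo_pi reprK. Qed.

Lemma quo_pi_eq x y : quo_pi x = quo_pi y <-> S (x - y).
Proof.
rewrite /quo_pi; split=> [e|Sxy].
  by move/eqP: e; rewrite -Quotient.idealrBE => /asboolP.
by apply/eqP; rewrite -Quotient.idealrBE; apply/asboolP.
Qed.

Lemma quo_piD x y : quo_pi (x + y) = quo_pi x + quo_pi y.
Proof. by rewrite /quo_pi; apply: Quotient.pi_add. Qed.

Definition quo_scale (a : A) (q : quomod) : quomod := quo_pi (a *: repr q).

Lemma quo_scale_pi a x : quo_scale a (quo_pi x) = quo_pi (a *: x).
Proof.
apply/quo_pi_eq; rewrite -scalerBr -[_ *: _]addr0; apply: hS.2; last by case: hS.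
by apply/quo_pi_eq; rewrite /quo_pi reprK.
Qed.

Let scaleA a b q : quo_scale a (quo_scale b q) = quo_scale (a * b) q.
Proof. by have [x <-] := quo_piK q; rewrite !quo_scale_pi scalerA. Qed.

Let scale1 : left_id 1 quo_scale.
Proof. by move=> q; have [x <-] := quo_piK q; rewrite quo_scale_pi scale1r. Qed.

Let scaleDr : right_distributive quo_scale +%R.
Proof.
move=> a q r; have [x <-] := quo_piK q; have [y <-] := quo_piK r.
by rewrite -quo_piD !quo_scale_pi -quo_piD scalerDr.
Qed.

Let scaleDl q : {morph quo_scale^~ q : a b / a + b}.
Proof. by move=> a b; have [x <-] := quo_piK q; rewrite !quo_scale_pi -quo_piD scalerDl. Qed.

HB.instance Definition _ :=
  GRing.Zmodule_isLmodule.Build A quomod scaleA scale1 scaleDr scaleDl.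

Fact quo_pi_linear : linear quo_pi.
Proof. by move=> a x y; rewrite quo_piD -quo_scale_pi. Qed.

Definition quo_map : {linear M -> quomod} := lin_map quo_pi_linear.

Lemma quo_map_surj q : exists x, quo_map x = q.
Proof. exact: quo_piK. Qed.

Lemma quo_map_eq0 x : quo_map x = 0 <-> S x.
Proof. by rewrite -(linear0 quo_map) -[X in S X]subr0; apply: quo_pi_eq. Qed.

End QuotientModule.
End Modules.

Arguments sub_incl : simpl never.

(** * Projective dimension by successive syzygies *)

Section Homological.
Variable A : nzRingType.
Implicit Types K L M N P Q R : lmodType A.

Definition short_exact K P M : Prop :=
  exists (i : {linear K -> P}) (g : {linear P -> M}),
    [/\ injective i, forall y, exists x, g x = y
      & forall x, g x = 0 <-> exists y, i y = x].

Definition retract M N : Prop :=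
  exists (f : {linear M -> N}) (g : {linear N -> M}), forall x, g (f x) = x.

Lemma linear_factor K P N (i : {linear K -> P}) (f : {linear N -> P}) :
  injective i -> (forall x, exists y, i y = f x) ->
  exists h : {linear N -> K}, forall x, i (h x) = f x.
Proof.
move=> inj_i fi; have /choice[h hP] : forall x, exists y, i y = f x by [].
have lin_h : linear h by move=> a x y; apply: inj_i; rewrite linearP !hP linearP.
by exists (lin_map lin_h).
Qed.

Lemma projective_retract M N : retract M N -> projective N -> projective M.
Proof.
move=> [f [g gf]] pN U V p q surj_p.
have [h hP] := pN U V p (q \o g) surj_p.
by exists (h \o f) => x /=; rewrite hP /= gf.
Qed.

Definition copair M N P (f : {linear M -> P}) (g : {linear N -> P}) (x : M * N) : P :=
  f x.1 + g x.2.

Lemma copair_linear M N P (f : {linear M -> P}) (g : {linear N -> P}) :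
  linear (copair f g).
Proof. by move=> a x y; rewrite /copair !linearP /= scalerDr addrACA. Qed.

Definition pair_map M N P (f : {linear P -> M}) (g : {linear P -> N}) (x : P) :
  (M * N)%type := (f x, g x).

Lemma pair_map_linear M N P (f : {linear P -> M}) (g : {linear P -> N}) :
  linear (pair_map f g).
Proof. by move=> a x y; rewrite /pair_map !linearP. Qed.

Lemma inl_linear M N : linear (fun x : M => (x, 0 : N)).
Proof. by move=> a x y; congr pair; rewrite /= scaler0 addr0. Qed.

Lemma inr_linear M N : linear (fun x : N => (0 : M, x)).
Proof. by move=> a x y; congr pair; rewrite /= scaler0 addr0. Qed.

Lemma projective_prod M N :
  projective M -> projective N -> projective (M * N)%type.
Proof.
move=> pM pN U V p q surj_p.
have [f fP] := pM U V p (q \o lin_map (@inl_linear M N)) surj_p.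
have [g gP] := pN U V p (q \o lin_map (@inr_linear M N)) surj_p.
exists (lin_map (copair_linear f g)) => -[x y].
rewrite /= /copair linearD fP gP /= -linearD; congr (q _).
by congr pair; rewrite /= ?addr0 ?add0r.
Qed.

Lemma projective_zero M : (forall x : M, x = 0) -> projective M.
Proof.
move=> M0 U V p q surj_p; exists \0 => x /=.
by rewrite (M0 x) !linear0.
Qed.

(** Projective dimension smaller than [d]. Starting from the zero module rather
    than from the projective ones makes the base cases of the inductions trivial. *)
Fixpoint pd_lt d M : Prop :=
  if d is d'.+1 then
    exists K P, [/\ projective P, short_exact K P M & pd_lt d' K]
  else forall x : M, x = 0.

Lemma pd_lt0 d M : (forall x : M, x = 0) -> pd_lt d M.
Proof.
elim: d M => [//|d IH] M M0; exists M, M; split; [exact: projective_zero| |exact: IH].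
exists idfun, idfun; split=> // [y|x]; first by exists y.
by split=> [_|_]; [exists x | exact: M0].
Qed.

Lemma pd_ltS d M : pd_lt d M -> pd_lt d.+1 M.
Proof.
elim: d M => [|d IH] M; first exact: (@pd_lt0 1 M).
by move=> [K [P [pP sKPM /IH dK]]]; exists K, P.
Qed.

Lemma pd_lt_leq d e M : (d <= e)%N -> pd_lt d M -> pd_lt e M.
Proof. by move=> /subnK <-; elim: (e - d)%N => // c IH /IH /pd_ltS. Qed.

Lemma pd_lt1_projective M : pd_lt 1 M -> projective M.
Proof.
move=> [K [P [pP [i [g [_ surj_g ker_g]]] K0]]].
have inj_g : injective g.
  move=> x y e; apply/eqP; rewrite -subr_eq0; apply/eqP.
  have /ker_g[z <-] : g (x - y) = 0 by rewrite linearB e subrr.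
  by rewrite (K0 z) linear0.
have [h hP] := linear_factor (f := idfun) inj_g surj_g.
by apply: projective_retract pP; exists h, g.
Qed.

Lemma short_exact_kernel P M (g : {linear P -> M}) :
  (forall y, exists x, g x = y) ->
  short_exact (submod (kernel_submodule g)) P M.
Proof.
move=> surj_g; exists (sub_incl _), g; split=> // [|x]; first exact: sub_incl_inj.
split=> [gx|[y <-]]; first exact: sub_lift.
exact: (sub_inclP y).
Qed.

(** The horseshoe lemma: the projective modules over the two ends add up to one over
    the middle, and the kernels form a short exact sequence again. *)
Lemma pd_lt_short_exact d K M N :
  short_exact K M N -> pd_lt d K -> pd_lt d N -> pd_lt d M.
Proof.
elim: d K M N => [|d IH] K M N [i [g [inj_i surj_g ker_g]]].
  move=> K0 N0 x; have /ker_g[y <-] : g x = 0 by exact: N0.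
  by rewrite (K0 y) linear0.
move=> [K1 [P1 [pP1 [i1 [g1 [inj1 surj1 ker1]]] dK1]]].
move=> [K2 [P2 [pP2 [i2 [g2 [inj2 surj2 ker2]]] dK2]]].
have [h hP] := pP2 _ _ g g2 surj_g.
(* [h] lifts [P2 -> N] through [M -> N]. *)
pose e := lin_map (copair_linear (i \o g1) h).
have gi y : g (i y) = 0 by apply/ker_g; exists y.
have surj_e m : exists x, e x = m.
  have [b gb] := surj2 (g m).
  have /ker_g[y iy] : g (m - h b) = 0 by rewrite linearB hP gb subrr.
  have [a ga] := surj1 y.
  by exists (a, b); rewrite /= /copair /= ga iy addrNK.
have sK := short_exact_kernel surj_e.
exists (submod (kernel_submodule e)), (P1 * P2)%type; split => //.
  exact: projective_prod.
apply: (IH K1 _ K2) => //.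
have [j jP] : exists j : {linear K1 -> submod (kernel_submodule e)},
    forall x, sub_incl _ (j x) = (lin_map (@inl_linear P1 P2) \o i1) x.
  apply: sub_factor => x /=; rewrite /copair /= linear0 addr0.
  have /ker1-> : exists y, i1 y = i1 x by exists x.
  by rewrite linear0.
have [q qP] : exists q : {linear submod (kernel_submodule e) -> K2},
    forall x, i2 (q x) = (snd \o sub_incl _) x.
  apply: linear_factor => // x; apply/ker2; rewrite -hP.
  have := sub_inclP x; rewrite /= /copair => /eqP; rewrite addrC addr_eq0 => /eqP->.
  by rewrite linearN gi oppr0.
exists j, q; split=> [x y exy|y|x].
- apply: inj1; have := jP x; rewrite exy jP /=.
  by case.
- have [b bP] : exists b, h (i2 y) = i b.
    have /ker_g[b <-] : g (h (i2 y)) = 0 by rewrite hP; apply/ker2; exists y.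
    by exists b.
  have [a aP] := surj1 b.
  have [z zP] : exists z : submod (kernel_submodule e), sub_incl _ z = (- a, i2 y).
    by apply: sub_lift; rewrite /= /copair /= linearN aP linearN bP addNr.
  by exists z; apply: inj2; rewrite qP; apply: (congr1 snd zP).
- split=> [qx|[y <-]].
    have x2 : (sub_incl _ x).2 = 0 by have := qP x; rewrite qx linear0 => /= <-.
    have [y yP] : exists y, i1 y = (sub_incl _ x).1.
      apply/ker1/inj_i; have := sub_inclP x; rewrite /= /copair x2 linear0 addr0 => e0.
      by rewrite linear0; apply: e0.
    exists y; apply: sub_incl_inj; rewrite jP /= yP.
    by rewrite [RHS]surjective_pairing; congr pair.
  by apply: inj2; rewrite qP linear0; apply: (congr1 snd (jP y)).
Qed.

Lemma short_exact_prodr K P M Q :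
  short_exact K P M -> short_exact K (P * Q)%type (M * Q)%type.
Proof.
move=> [i [g [inj_i surj_g ker_g]]].
exists (lin_map (@inl_linear P Q) \o i), (lin_map (pair_map_linear (g \o fst) snd)).
split=> [x y /= [] /inj_i //|[y q]|[x q]].
  by have [x <-] := surj_g y; exists (x, q).
rewrite /= /pair_map /=; split=> [[gx ->]|[y [<- <-]]].
  by have /ker_g[y <-] := gx; exists y.
by congr pair; apply/ker_g; exists y.
Qed.

Lemma short_exact_split M N : short_exact M (M * N)%type N.
Proof.
exists (lin_map (@inl_linear M N)), snd; split=> [x y []//|y|[x y]].
  by exists (0, y).
by split=> [/= ->|[z [_ <-]]]; first by exists x.
Qed.

(** Lift the retraction to the projective modules and restrict it to the kernels.
    The restriction is the identity up to a map that factors through the inclusion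
    of [K] in [R], whence the extra summand [R]. *)
Lemma syzygy_retract K R M K' R' N :
  short_exact K R M -> projective R -> short_exact K' R' N -> projective R' ->
  retract M N -> retract K (K' * R)%type.
Proof.
move=> [i [g [inj_i surj_g ker_g]]] pR [i' [g' [inj_i' surj_g' ker_g']]] pR'.
move=> [f [r rf]].
have gi y : g (i y) = 0 by apply/ker_g; exists y.
have gi' y : g' (i' y) = 0 by apply/ker_g'; exists y.
have [F FP] := pR _ _ g' (f \o g) surj_g'.
have [G GP] := pR' _ _ g (r \o g') surj_g.
have [f0 f0P] : exists h : {linear K -> K'}, forall x, i' (h x) = (F \o i) x.
  by apply: linear_factor => // x; apply/ker_g'; rewrite /= FP /= gi linear0.
have [r0 r0P] : exists h : {linear K' -> K}, forall x, i (h x) = (G \o i') x.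
  by apply: linear_factor => // x; apply/ker_g; rewrite /= GP /= gi' linear0.
have [H HP] : exists h : {linear R -> K}, forall x, i (h x) = (idfun \- (G \o F)) x.
  apply: linear_factor => // x; apply/ker_g.
  by rewrite /= linearB /= GP /= FP /= rf subrr.
exists (lin_map (pair_map_linear f0 i)), (lin_map (copair_linear r0 H)) => x.
apply: inj_i; rewrite /= /copair /pair_map /= linearD r0P HP /= f0P /=.
by rewrite addrCA subrr addr0.
Qed.

Lemma pd_lt_syzygy d (X R : nat -> lmodType A) N Q :
  (forall i, projective (R i)) ->
  (forall i, (i < d)%N -> short_exact (X i.+1) (R i) (X i)) ->
  pd_lt d.+1 N -> projective Q -> retract (X 0%N) (N * Q)%type -> projective (X d).
Proof.
elim: d X R N Q => [|d IH] X R N Q pR sX dN pQ rX.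
  apply: projective_retract rX _; apply: projective_prod => //.
  exact: pd_lt1_projective.
have [K [P [pP sN dK]]] := dN.
apply: (IH (X \o succn) (R \o succn) K (R 0%N)) => //=.
  by move=> i di; apply: sX.
apply: (syzygy_retract (sX 0%N isT) (pR 0%N) (short_exact_prodr Q sN)) => //.
exact: projective_prod.
Qed.

(** A substitute for dimension shifting with Schanuel's lemma: comparing with a
    short resolution shows the [d]-th syzygy to be a retract of a projective module. *)
Lemma projective_nth_syzygy d (X R : nat -> lmodType A) :
  (forall i, projective (R i)) ->
  (forall i, (i < d)%N -> short_exact (X i.+1) (R i) (X i)) ->
  pd_lt d.+1 (X 0%N) -> projective (X d).
Proof.
move=> pR sX dX; apply: (pd_lt_syzygy pR sX dX (pR 0%N)).
by exists (lin_map (@inl_linear (X 0%N) (R 0%N))), fst.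
Qed.

(** The bound is strict, unlike in [projdim_le], so that the zero module has a
    resolution of length 0 and the induction can start there. *)
Definition resolution_lt (M : lmodType A) (d : nat) : Prop :=
  exists (P : nat -> lmodType A) (del : forall i, {linear P i.+1 -> P i})
         (eps : {linear P 0 -> M}),
    [/\ forall i, projective (P i),
        forall i, (d <= i)%N -> forall x : P i, x = 0,
        forall y, exists x, eps x = y,
        forall x, eps x = 0 <-> exists y, del 0 y = x
      & forall i x, del i x = 0 <-> exists y, del i.+1 y = x].

Lemma resolution_ltP M d : resolution_lt M d <-> pd_lt d M.
Proof.
split.
  elim: d M => [|d IH] M [P [del [eps [pP P0 surj_e ker_e ker_del]]]].
    by move=> y; have [x <-] := surj_e y; rewrite (P0 0%N _ x) // linear0.
  exists (submod (kernel_submodule eps)), (P 0%N); split => //.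
    exact: short_exact_kernel.
  apply: IH; have [eps1 eps1P] :
      exists f : {linear P 1%N -> submod (kernel_submodule eps)},
      forall x, sub_incl _ (f x) = del 0%N x.
    by apply: sub_factor => x; apply/ker_e; exists x.
  exists (P \o succn), (fun i => del i.+1), eps1; split=> [i|i di x|y|x|i x] //=.
  - exact: P0.
  - have /ker_e[x xP] := sub_inclP y.
    by exists x; apply: sub_incl_inj; rewrite eps1P.
  - rewrite -ker_del -eps1P; split=> [->|]; first by rewrite linear0.
    by move=> e; apply: sub_incl_inj; rewrite e linear0.
  - exact: ker_del.
elim: d M => [|d IH] M.
  move=> M0; exists (fun=> M), (fun=> idfun), idfun.
  have triv (x : M) : x = 0 <-> exists y, idfun y = x.
    by split=> [_|_]; [exists x | exact: M0].
  by split=> // [_|y]; [exact: projective_zero | exists y].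
move=> [K [P [pP [i [g [inj_i surj_g ker_g]]]]]] /IH.
move=> [P' [del [eps [pP' P0 surj_e ker_e ker_del]]]].
pose P1 j : lmodType A := if j is j'.+1 then P' j' else P.
pose del1 j : {linear P1 j.+1 -> P1 j} :=
  match j return {linear P1 j.+1 -> P1 j} with
  | 0 => i \o eps | j'.+1 => del j' end.
exists P1, del1, g; split=> // [[|j]|[|j]|x|[|j] x] //=.
- exact: P0.
- rewrite ker_g; split=> [[y <-]|[z <-]]; last by exists (eps z).
  by have [z <-] := surj_e y; exists z.
- rewrite -ker_e -(linear0 i); split=> [/inj_i //|->].
  by rewrite linear0.
- exact: ker_del.
Qed.

Lemma projdim_leP M d : projdim_le M d <-> pd_lt d.+1 M.
Proof. exact: resolution_ltP. Qed.

End Homological.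

(** * Lifting linear maps out of an arbitrary vector space *)

Section VectorSpaceLift.
Variables (k : fieldType) (A : algType k).

Definition scalar_linear (V : lmodType k) (W : lmodType A) (f : V -> W) : Prop :=
  forall c x y, f (c *: x + y) = c%:A *: f x + f y.

Lemma scalar_linear0 (V : lmodType k) (W : lmodType A) (f : V -> W) :
  scalar_linear f -> f 0 = 0.
Proof.
move=> lf; have := lf 1 0 0; rewrite scaler0 addr0 scale1r scale1r => /eqP.
by rewrite -subr_eq0 opprD addrA subrr sub0r oppr_eq0 => /eqP.
Qed.

Lemma alg_scale_scale (W : lmodType A) c d (w : W) : c%:A *: (d%:A *: w) = (c * d)%:A *: w.
Proof. by rewrite scalerA mulr_algl scalerA. Qed.

(** A maximal linear lift defined on a subspace of [V], given by Zorn's lemma, is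
    defined everywhere; partial lifts are represented by their graphs. *)
Lemma scalar_linear_lift (V : lmodType k) (U W : lmodType A)
    (p : {linear U -> W}) (f : V -> W) :
  (forall y, exists x, p x = y) -> scalar_linear f ->
  exists2 h : V -> U, scalar_linear h & forall v, p (h v) = f v.
Proof.
move=> surj_p lf; have f0 := scalar_linear0 lf.
pose partial (G : classical_sets.set (V * U)) :=
  [/\ forall c x y, G x -> G y -> G (c *: x.1 + y.1, c%:A *: x.2 + y.2),
      forall x, G x -> p x.2 = f x.1
    & forall x, G x -> x.1 = 0 -> x.2 = 0].
have [F Fpartial Ftot|G [[Glin Gp Gfun] Gmax]] := classical_sets.Zorn_bigcup (P := partial).
  split=> [c x y [X FX Xx] [Y FY Yy]|x [X FX]|x [X FX]].
  - have [/(_ _ Xx) Yx|/(_ _ Yy) Xy] := Ftot _ _ FX FY.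
      by exists Y => //; have [+ _ _] := Fpartial _ FY; apply.
    by exists X => //; have [+ _ _] := Fpartial _ FX; apply.
  - by have [_ + _] := Fpartial _ FX; apply.
  - by have [_ _] := Fpartial _ FX; apply.
(* The empty graph also passes the tests of [partial]; a maximal one is not empty. *)
have G0 : G (0, 0).
  apply: contrapT => nG0.
  apply: (Gmax (fun x => G x \/ x = (0, 0))).
    by split=> [x|/(_ (0, 0))]; [left|move/(_ (or_intror erefl))].
  split=> [c x y /= [Gx|->] [Gy|->]|x [|->]|x [|->]] //=.
  - by left; apply: Glin.
  - left; rewrite !addr0; have := Glin (c - 1) x x Gx Gx.
    by rewrite !scalerBl !scale1r !addrNK.
  - by left; rewrite !scaler0 !add0r -surjective_pairing.
  - by right; rewrite !scaler0 !addr0.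
  - exact: Gp.
  - by rewrite linear0 f0.
  - exact: Gfun.
have Gtot v : exists u, G (v, u).
  apply: contrapT => nv; have [u pu] := surj_p (f v).
  have uniq_c c x : G x -> x.1 = c *: v -> c = 0.
    move=> Gx xv; apply/eqP/negPn/negP => c0; apply: nv; exists (c^-1%:A *: x.2).
    have := Glin c^-1 _ _ Gx G0; rewrite !addr0 xv scalerA mulVf // scale1r.
    by [].
  apply: (Gmax (fun x => exists c y, G y /\ x = (c *: v + y.1, c%:A *: u + y.2))).
    split=> [x Gx|/(_ (v, u)) Gv].
      by exists 0, x; split=> //; rewrite !scale0r !add0r -surjective_pairing.
    apply: nv; exists u; apply: Gv.
    by exists 1, (0, 0); split=> //; rewrite !addr0 !scale1r.
  split=> [c x y [c1 [x1 [Gx1 ->]]] [c2 [x2 [Gx2 ->]]]|x [c [y [Gy ->]]]|x [c [y [Gy ->]]]] /=.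
  - exists (c * c1 + c2), (c *: x1.1 + x2.1, c%:A *: x1.2 + x2.2).
    split; first exact: Glin.
    congr pair => /=; first by rewrite scalerDr scalerDl scalerA addrACA.
    by rewrite scalerDr !scalerDl alg_scale_scale addrACA.
  - by rewrite linearD linearZ /= pu (Gp _ Gy) lf.
  - move=> e; have c0 : - c = 0.
      by apply: (uniq_c _ _ Gy); apply/eqP; rewrite scaleNr -addr_eq0 addrC e.
    move/eqP: c0 e; rewrite oppr_eq0 => /eqP->; rewrite !scale0r !add0r.
    exact: Gfun.
have /choice[h hG] := Gtot.
exists h => [c x y|v]; last exact: (Gp _ (hG v)).
have Gxy := Glin c _ _ (hG x) (hG y).
have := Glin (-1) _ _ Gxy (hG (c *: x + y)).
move=> /Gfun /=; rewrite scaleN1r addNr => /(_ erefl) /eqP.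
by rewrite scaleN1r scaleN1r addrC subr_eq0 => /eqP.
Qed.

End VectorSpaceLift.

(** * Modules over the triangular matrix algebra of a chord diagram *)

Definition glued_triangular (k : fieldType) n (al : 'S_n) (X : 'M[k]_n) : Prop :=
  (forall i j : 'I_n, (j < i)%N -> X i j = 0) /\
  forall i, X (al i) (al i) = X i i.

(** Presents [A] as the algebra of the upper triangular matrices that have equal
    diagonal entries at the two ends of each chord. *)
Record triangular_model (k : fieldType) n (al : 'S_n) (A : algType k) :=
  TriangularModel {
    entries : A -> 'M[k]_n;
    entriesP : forall c a b, entries (c *: a + b) = c *: entries a + entries b;
    entries1 : entries 1 = 1%:M;
    entriesM : forall a b, entries (a * b) = entries a *m entries b;
    entries_inj : injective entries;
    entries_glued : forall a, glued_triangular al (entries a);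
    entries_surj : forall X, glued_triangular al X -> exists a, entries a = X }.

Section Model.
Variables (k : fieldType) (n : nat) (al : 'S_n) (A : algType k).
Variable T : triangular_model al A.
Local Notation mx a := (entries T a).

Lemma entriesD a b : mx (a + b) = mx a + mx b.
Proof. by rewrite -[a]scale1r entriesP !scale1r. Qed.

Lemma entries0 : mx 0 = 0.
Proof. by apply: (addrI (mx 0)); rewrite -entriesD !addr0. Qed.

Lemma entriesZ c a : mx (c *: a) = c *: mx a.
Proof. by rewrite -[_ *: a]addr0 entriesP entries0 addr0. Qed.

Lemma entries_sum I (r : seq I) (F : I -> A) :
  mx (\sum_(i <- r) F i) = \sum_(i <- r) mx (F i).
Proof. exact: (big_morph _ entriesD entries0). Qed.

Lemma entries_alg c : mx c%:A = c%:M.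
Proof. by rewrite entriesZ entries1 scalemx1. Qed.

Lemma entries_lower a (i j : 'I_n) : (j < i)%N -> mx a i j = 0.
Proof. by have [+ _] := entries_glued T a; apply. Qed.

Lemma entries_diag a i : mx a (al i) (al i) = mx a i i.
Proof. by have [_] := entries_glued T a; apply. Qed.

(** The model is a parameter of the type so that the action of [A] by matrix
    multiplication can be attached to it. *)
Definition columns (t : triangular_model al A) (V : lmodType k) : Type :=
  {ffun 'I_n -> V}.

HB.instance Definition _ V := GRing.Zmodule.copy (columns T V) {ffun 'I_n -> V}.

Section Columns.
Variable V : lmodType k.
Implicit Types x y : columns T V.

Definition col_scale (a : A) x : columns T V := [ffun i => \sum_j mx a i j *: x j].

Let scaleA a b x : col_scale a (col_scale b x) = col_scale (a * b) x.
Proof.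
apply/ffunP => i; rewrite !ffunE entriesM.
transitivity (\sum_j \sum_l (mx a i j * mx b j l) *: x l).
  by apply: eq_bigr => j _; rewrite ffunE scaler_sumr; apply: eq_bigr => l _; rewrite scalerA.
by rewrite exchange_big; apply: eq_bigr => l _; rewrite mxE scaler_suml.
Qed.

Let scale1 : left_id 1 col_scale.
Proof.
move=> x; apply/ffunP => i; rewrite ffunE entries1 (bigD1 i) //= big1.
  by rewrite mxE eqxx scale1r addr0.
by move=> j ji; rewrite mxE eq_sym (negPf ji) scale0r.
Qed.

Let scaleDr : right_distributive col_scale +%R.
Proof.
move=> a x y; apply/ffunP => i; rewrite !ffunE -big_split; apply: eq_bigr => j _.
by rewrite /= ffunE scalerDr.
Qed.

Let scaleDl x : {morph col_scale^~ x : a b / a + b}.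
Proof.
move=> a b; apply/ffunP => i; rewrite !ffunE -big_split; apply: eq_bigr => j _.
by rewrite /= entriesD mxE scalerDl.
Qed.

HB.instance Definition _ :=
  GRing.Zmodule_isLmodule.Build A (columns T V) scaleA scale1 scaleDr scaleDl.

Lemma col_scaleE a x i : (a *: x) i = \sum_j mx a i j *: x j.
Proof. by rewrite ffunE. Qed.

Lemma col_addE x y i : (x + y) i = x i + y i.
Proof. by rewrite ffunE. Qed.

Lemma col_zeroE i : (0 : columns T V) i = 0.
Proof. by rewrite ffunE. Qed.

Lemma col_algE c x i : (c%:A *: x) i = c *: x i.
Proof.
rewrite col_scaleE entries_alg (bigD1 i) //= big1 ?addr0 ?mxE ?eqxx //.
by move=> j ji; rewrite mxE eq_sym (negPf ji) scale0r.
Qed.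

Definition supported (j : nat) x : Prop := forall i : 'I_n, (j <= i)%N -> x i = 0.

Lemma supported_scaleE a x (i : 'I_n) : supported i.+1 x ->
  (a *: x) i = mx a i i *: x i.
Proof.
move=> sx; rewrite col_scaleE (bigD1 i) //= big1 ?addr0 // => j ji.
have [lt_ji|lt_ij|/val_inj e] := ltngtP j i; last by rewrite e eqxx in ji.
  by rewrite entries_lower ?scale0r.
by rewrite sx ?scaler0.
Qed.

Lemma supported_submodule j : submodule_of (supported j).
Proof.
split=> [i _|a x y sx sy i ji]; first by rewrite ffunE.
rewrite col_addE sy // addr0 col_scaleE big1 // => l _.
have [lt_li|le_il] := ltnP l i; first by rewrite entries_lower ?scale0r.
by rewrite sx ?scaler0 // (leq_trans ji).
Qed.

(** The uniserial module of an initial segment of the maximal path, tensored with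
    [V]. *)
Definition Umod (j : nat) : lmodType A := submod (supported_submodule j).

Definition glued (i : 'I_n) (z : columns T V * columns T V) : Prop :=
  [/\ supported i.+1 z.1, supported (al i).+1 z.2 & z.1 i = z.2 (al i)].

Lemma glued_submodule i : submodule_of (glued i).
Proof.
split=> [|a x y [x1 x2 ex] [y1 y2 ey]]; first by split=> //= [j _|j _|]; rewrite !ffunE.
split; [exact: (supported_submodule _).2|exact: (supported_submodule _).2|].
by rewrite /= !col_addE !supported_scaleE // entries_diag ex ey.
Qed.

(** The projective module at the vertex shared by [i] and [al i], tensored with [V]:
    a matrix killed on the right by the other idempotents has only the columns [i]
    and [al i], and these share a diagonal entry. *)
Definition Rmod (i : 'I_n) : lmodType A := submod (glued_submodule i).

End Columns.

Arguments supported : simpl never.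

Hypothesis alK : forall i, al (al i) = i.
Hypothesis al_neq : forall i, al i <> i.

Let al_neqF i : (al i == i) = false.
Proof. by apply/eqP/al_neq. Qed.

Let al_neqF' i : (i == al i) = false.
Proof. by rewrite eq_sym al_neqF. Qed.

Section Generator.
Variables (V : lmodType k) (i : 'I_n).

Definition column_at (j : 'I_n) (v : V) : columns T V := [ffun l => if l == j then v else 0].

Lemma column_at_supported (j : 'I_n) v : supported j.+1 (column_at j v).
Proof. by move=> l jl; rewrite ffunE; case: eqP => // e; rewrite e ltnn in jl. Qed.

Lemma column_at_linear c v w j :
  column_at j (c *: v + w) = c%:A *: column_at j v + column_at j w.
Proof.
apply/ffunP => l; rewrite col_addE col_algE !ffunE.
by case: eqP; rewrite ?scaler0 ?addr0.
Qed.

Lemma column_at_scaleE a j v l : (a *: column_at j v) l = mx a l j *: v.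
Proof.
rewrite col_scaleE (bigD1 j) //= big1 ?ffunE ?eqxx ?addr0 // => r /negPf rj.
by rewrite ffunE rj scaler0.
Qed.

Fact generator_glued v : glued i (column_at i v, column_at (al i) v).
Proof. by split; [exact: column_at_supported|exact: column_at_supported|rewrite !ffunE !eqxx]. Qed.

(** The idempotent of the vertex of [i], tensored with [v]. *)
Definition generator (v : V) : Rmod V i :=
  projT1 (cid (sub_lift (glued_submodule V i) (generator_glued v))).

Lemma generatorE v :
  sub_incl _ (generator v) = (column_at i v, column_at (al i) v).
Proof. by rewrite /generator; case: cid. Qed.

Lemma generator_linear : scalar_linear generator.
Proof.
move=> c x y; apply: sub_incl_inj; rewrite linearP !generatorE.
by rewrite !column_at_linear.
Qed.
End Generator.

Section Basis.
Variable i : 'I_n.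

(* A basis of the left ideal generated by the idempotent of the vertex of [i]: the
   idempotent itself is [left_mx i], the matrix units of column [i] above the diagonal
   are the [left_mx l] with [l < i], those of column [al i] are the [right_mx l] with
   [l < al i]; the remaining ones vanish. *)
Let left_mx (l : 'I_n) : 'M[k]_n := \matrix_(r, s)
  ([&& s == i, r == l & (l <= i)%N] || [&& s == al i, r == al i & l == i])%:R.
Let right_mx (l : 'I_n) : 'M[k]_n := \matrix_(r, s)
  [&& s == al i, r == l & (l < al i)%N]%:R.

Let left_mx_glued l : glued_triangular al (left_mx l).
Proof.
split=> [r s sr|r]; rewrite !mxE.
  rewrite (_ : _ || _ = false) //.
  apply/negP => /orP[/and3P[/eqP es /eqP er li]|/and3P[/eqP es /eqP er _]].
    by rewrite es er ltnNge li in sr.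
  by rewrite es er ltnn in sr.
have e1 : (al r == i) = (r == al i) by rewrite (can2_eq alK alK).
have e2 : (al r == al i) = (r == i) by rewrite (inj_eq perm_inj).
have e3 l' : (i == l') && (l' <= i)%N = (l' == i).
  by rewrite eq_sym; case: eqP => // ->; rewrite leqnn.
congr (nat_of_bool _)%:R; rewrite e1 e2.
have [->|ri] := eqVneq r i; first by rewrite e3 al_neqF' /= orbF.
have [->|rai] := eqVneq r (al i); last by [].
by rewrite alK /= e3 orbF.
Qed.

Let right_mx_glued l : glued_triangular al (right_mx l).
Proof.
split=> [r s sr|r]; rewrite !mxE.
  case: and3P => // -[/eqP es /eqP er lt]; by rewrite es er ltnNge ltnW in sr.
case: and3P => [[/eqP e1 /eqP e2 lt]|_]; first by rewrite -e2 e1 ltnn in lt.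
by case: and3P => // -[/eqP e1 /eqP e2 lt]; rewrite -e2 e1 ltnn in lt.
Qed.

Definition left_elt l : A := projT1 (cid (entries_surj T (left_mx_glued l))).
Definition right_elt l : A := projT1 (cid (entries_surj T (right_mx_glued l))).

Lemma left_eltE l r s : mx (left_elt l) r s =
  ([&& s == i, r == l & (l <= i)%N] || [&& s == al i, r == al i & l == i])%:R.
Proof. by rewrite /left_elt; case: cid => x /= ->; rewrite mxE. Qed.

Lemma right_eltE l r s : mx (right_elt l) r s =
  [&& s == al i, r == l & (l < al i)%N]%:R.
Proof. by rewrite /right_elt; case: cid => x /= ->; rewrite mxE. Qed.

Lemma left_elt_col l r : mx (left_elt l) r i = ((r == l) && (l <= i)%N)%:R.
Proof. by rewrite left_eltE eqxx al_neqF' orbF. Qed.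

Lemma left_elt_colC l r : mx (left_elt l) r (al i) = ((l == i) && (r == al i))%:R.
Proof. by rewrite left_eltE eqxx al_neqF /= andbC. Qed.

Lemma right_elt_col l r : mx (right_elt l) r i = 0.
Proof. by rewrite right_eltE al_neqF'. Qed.

Lemma right_elt_colC l r : mx (right_elt l) r (al i) = ((r == l) && (l < al i)%N)%:R.
Proof. by rewrite right_eltE eqxx. Qed.

Lemma sum_pick (V : lmodType k) (P : pred 'I_n) (r : 'I_n) (F : 'I_n -> V) :
  \sum_l ((r == l) && P l)%:R *: F l = (P r)%:R *: F r.
Proof.
rewrite (bigD1 r) //= eqxx big1 ?addr0 // => l lr.
by rewrite eq_sym (negPf lr) scale0r.
Qed.

Lemma sum_pickr (P : pred 'I_n) (r : 'I_n) (F : 'I_n -> k) :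
  \sum_l F l * ((r == l) && P l)%:R = F r * (P r)%:R.
Proof.
rewrite (bigD1 r) //= eqxx big1 ?addr0 // => l lr.
by rewrite eq_sym (negPf lr) mulr0.
Qed.

(** The matrices are compared entry by entry; the diagonal entry in position
    [(al i, al i)] comes from [left_elt i], as diagonal entries are glued. *)
Lemma mul_idempotent a : a * left_elt i =
  \sum_l mx a l i *: left_elt l + \sum_l mx a l (al i) *: right_elt l.
Proof.
apply: (entries_inj (t := T)); apply/matrixP => r s.
have rhs : mx (\sum_l mx a l i *: left_elt l + \sum_l mx a l (al i) *: right_elt l) r s
  = \sum_l mx a l i * mx (left_elt l) r s + \sum_l mx a l (al i) * mx (right_elt l) r s.
  rewrite entriesD mxE !entries_sum !summxE; congr (_ + _);
  by apply: eq_bigr => l _; rewrite entriesZ mxE.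
rewrite rhs entriesM mxE.
have [->|si] := eqVneq s i.
  rewrite [X in _ = _ + X]big1 ?addr0 => [|l _]; last by rewrite right_elt_col mulr0.
  rewrite (eq_bigr (fun l => mx a r l * ((i == l) && true)%:R)) => [|l _].
    rewrite (sum_pickr xpredT) mulr1.
    rewrite (eq_bigr (fun l => mx a l i * ((r == l) && (l <= i)%N)%:R)) => [|l _].
      rewrite (sum_pickr (fun l => l <= i)%N).
      by case: leqP => [_|/entries_lower->]; rewrite ?mulr1 ?mul0r.
    by rewrite left_elt_col.
  by rewrite left_elt_col leqnn eq_sym.
have [->|sai] := eqVneq s (al i).
  rewrite (eq_bigr (fun l => mx a r l * ((al i == l) && true)%:R)) => [|l _].
    rewrite (sum_pickr xpredT) mulr1.
    rewrite (eq_bigr (fun l => mx a l i * ((i == l) && (r == al i))%:R)) => [|l _].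
      rewrite (sum_pickr (fun=> r == al i)).
      rewrite (eq_bigr (fun l => mx a l (al i) * ((r == l) && (l < al i)%N)%:R)) => [|l _].
        rewrite (sum_pickr (fun l => l < al i)%N).
        have [lt|lt|/val_inj->] := ltngtP r (al i).
        - by rewrite -val_eqE /= ltn_eqF // mulr0 mulr1 add0r.
        - by rewrite entries_lower // -val_eqE /= gtn_eqF // !mulr0 addr0.
        - by rewrite eqxx mulr1 mulr0 addr0 entries_diag.
      by rewrite right_elt_colC.
    by rewrite left_elt_colC eq_sym.
  by rewrite left_elt_colC eqxx andbT eq_sym.
rewrite !big1 ?addr0 // => l _.
- by rewrite right_eltE (negPf sai) mulr0.
- by rewrite left_eltE (negPf si) (negPf sai) mulr0.
- by rewrite left_eltE (negPf si) (negPf sai) mulr0.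
Qed.

Section Lifting.
Variable V : lmodType k.
Implicit Types z : Rmod V i.

Definition fst_col z : columns T V := (sub_incl _ z).1.
Definition snd_col z : columns T V := (sub_incl _ z).2.

Lemma Rmod_ext z z' : (forall r, fst_col z r = fst_col z' r) ->
  (forall r, snd_col z r = snd_col z' r) -> z = z'.
Proof.
rewrite /fst_col /snd_col => e1 e2; apply: sub_incl_inj.
rewrite [LHS]surjective_pairing [RHS]surjective_pairing.
by congr pair; apply/ffunP.
Qed.

Lemma fst_colD z z' r : fst_col (z + z') r = fst_col z r + fst_col z' r.
Proof. by rewrite /fst_col linearD -col_addE. Qed.

Lemma snd_colD z z' r : snd_col (z + z') r = snd_col z r + snd_col z' r.
Proof. by rewrite /snd_col linearD -col_addE. Qed.

Lemma fst_col0 r : fst_col 0 r = 0.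
Proof. by rewrite /fst_col linear0 col_zeroE. Qed.

Lemma snd_col0 r : snd_col 0 r = 0.
Proof. by rewrite /snd_col linear0 col_zeroE. Qed.

Lemma fst_col_sum (F : 'I_n -> Rmod V i) r :
  fst_col (\sum_l F l) r = \sum_l fst_col (F l) r.
Proof. exact: (big_morph _ (fun z z' => fst_colD z z' r) (fst_col0 r)). Qed.

Lemma snd_col_sum (F : 'I_n -> Rmod V i) r :
  snd_col (\sum_l F l) r = \sum_l snd_col (F l) r.
Proof. exact: (big_morph _ (fun z z' => snd_colD z z' r) (snd_col0 r)). Qed.

Lemma fst_col_generator a v r : fst_col (a *: generator i v) r = mx a r i *: v.
Proof. by rewrite /fst_col linearZ_LR generatorE -column_at_scaleE. Qed.

Lemma snd_col_generator a v r : snd_col (a *: generator i v) r = mx a r (al i) *: v.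
Proof. by rewrite /snd_col linearZ_LR generatorE -column_at_scaleE. Qed.

Lemma generator_expand z :
  z = \sum_l left_elt l *: generator i (fst_col z l)
    + \sum_l right_elt l *: generator i (snd_col z l).
Proof.
have [z1 z2 ez] := sub_inclP z; rewrite -!/(fst_col z) -!/(snd_col z) in z1 z2 ez.
apply: Rmod_ext => r.
  rewrite fst_colD !fst_col_sum [X in _ + X]big1 ?addr0 => [|l _].
    rewrite (eq_bigr (fun l => ((r == l) && (l <= i)%N)%:R *: fst_col z l)) => [|l _].
      rewrite (sum_pick (fun l => l <= i)%N).
      by case: leqP => [_|/z1->]; rewrite ?scale1r ?scaler0.
    by rewrite fst_col_generator left_elt_col.
  by rewrite fst_col_generator right_elt_col scale0r.
rewrite snd_colD !snd_col_sum.
rewrite (eq_bigr (fun l => ((i == l) && (r == al i))%:R *: fst_col z l)) => [|l _].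
  rewrite (sum_pick (fun=> r == al i)).
  rewrite (eq_bigr (fun l => ((r == l) && (l < al i)%N)%:R *: snd_col z l)) => [|l _].
    rewrite (sum_pick (fun l => l < al i)%N).
    have [lt|lt|/val_inj->] := ltngtP r (al i).
    - by rewrite -val_eqE /= ltn_eqF // scale0r scale1r add0r.
    - by rewrite z2 // -val_eqE /= gtn_eqF // !scale0r addr0.
    - by rewrite eqxx scale1r scale0r addr0 ez.
  by rewrite snd_col_generator right_elt_colC.
by rewrite snd_col_generator left_elt_colC eq_sym.
Qed.

(** Homomorphisms out of [Rmod V i] are the linear maps from [V] to the part of
    the target fixed by the idempotent of [i]; those lift because vector spaces
    are projective. *)
Lemma Rmod_projective : projective (Rmod V i).
Proof.
move=> N W p q surj_p.
have lq : scalar_linear (fun v => q (generator i v)).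
  by move=> c x y; rewrite generator_linear linearP.
have [h0 lh0 h0P] := scalar_linear_lift surj_p lq.
have idem : left_elt i * left_elt i = left_elt i.
  rewrite mul_idempotent.
  rewrite (eq_bigr (fun l => ((i == l) && true)%:R *: left_elt l)) => [|l _].
    rewrite (sum_pick xpredT) scale1r big1 ?addr0 // => l _.
    rewrite left_elt_colC eqxx /=; have [->|_] := eqVneq l (al i); last by rewrite scale0r.
    rewrite scale1r; apply: (entries_inj (t := T)); apply/matrixP => r s.
    by rewrite right_eltE entries0 mxE ltnn !andbF.
  by rewrite left_elt_col leqnn eq_sym.
have idem_gen (v : V) : left_elt i *: generator i v = generator i v.
  apply: Rmod_ext => r.
    rewrite fst_col_generator left_elt_col leqnn andbT.
    by rewrite /fst_col generatorE ffunE; case: eqP; rewrite ?scale1r ?scale0r.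
  rewrite snd_col_generator left_elt_colC eqxx.
  by rewrite /snd_col generatorE ffunE; case: eqP; rewrite ?scale1r ?scale0r.
(* The lift [h0] need not be fixed by the idempotent; [h1] is. *)
pose h1 (v : V) := left_elt i *: h0 v.
have h1P (v : V) : p (h1 v) = q (generator i v).
  by rewrite linearZ /= h0P -linearZ /= idem_gen.
have lh1 c (v w : V) : h1 (c *: v + w) = c%:A *: h1 v + h1 w.
  by rewrite /h1 lh0 scalerDr !scalerA mulr_algl mulr_algr.
have h1D (v w : V) : h1 (v + w) = h1 v + h1 w by rewrite -[v]scale1r lh1 !scale1r.
have h1_0 : h1 0 = 0 by apply: (addrI (h1 0)); rewrite -h1D !addr0.
have h1Z c (v : V) : h1 (c *: v) = c%:A *: h1 v by rewrite -[_ *: v]addr0 lh1 h1_0 addr0.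
pose h z := \sum_l left_elt l *: h1 (fst_col z l) + \sum_l right_elt l *: h1 (snd_col z l).
have hD z z' : h (z + z') = h z + h z'.
  rewrite /h addrACA; congr (_ + _); rewrite -big_split; apply: eq_bigr => l _.
    by rewrite fst_colD h1D scalerDr.
  by rewrite snd_colD h1D scalerDr.
have h_0 : h 0 = 0 by apply: (addrI (h 0)); rewrite -hD !addr0.
have h_sum (F : 'I_n -> Rmod V i) : h (\sum_l F l) = \sum_l h (F l).
  exact: (big_morph _ hD h_0).
have h_gen a (v : V) : h (a *: generator i v) = a *: h1 v.
  have -> : a *: h1 v = (a * left_elt i) *: h1 v.
    rewrite -scalerA; congr (_ *: _); rewrite /h1 scalerA; congr (_ *: _).
    exact: esym idem.
  rewrite mul_idempotent scalerDl !scaler_suml /h.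
  congr (_ + _); apply: eq_bigr => l _.
    by rewrite fst_col_generator h1Z scalerA mulr_algr.
  by rewrite snd_col_generator h1Z scalerA mulr_algr.
have hZ a z : h (a *: z) = a *: h z.
  rewrite {1}(generator_expand z) scalerDr !scaler_sumr hD !h_sum.
  rewrite [in RHS]/h scalerDr !scaler_sumr.
  congr (_ + _); apply: eq_bigr => l _; by rewrite scalerA h_gen [in RHS]scalerA.
have lh : linear h by move=> a x y; rewrite hD hZ.
exists (lin_map lh) => z; rewrite [in RHS](generator_expand z) /= /h.
rewrite !linearD !linear_sum; congr (_ + _); apply: eq_bigr => l _;
  by rewrite linearZ_LR h1P linearZ_LR.
Qed.

End Lifting.
End Basis.
End Model.

(** * Syzygies and global dimension *)

Section ColumnSyzygies.
Variables (k : fieldType) (n : nat) (al : 'S_n) (A : algType k).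
Variable T : triangular_model al A.
Hypothesis alK : forall i, al (al i) = i.
Hypothesis al_neq : forall i, al i <> i.
Local Notation mx a := (entries T a).
Local Notation U V j := (Umod T V j).
Local Notation R V i := (Rmod T V i).

Section Syzygies.
Variable V : lmodType k.

Lemma Umod_zero (x : U V 0) : x = 0.
Proof.
apply: sub_incl_inj; rewrite linear0; apply/ffunP => i.
by rewrite (sub_inclP x) // col_zeroE.
Qed.

Lemma Rmod_to_Umod (i : 'I_n) :
  exists2 g : {linear R V i -> U V i.+1},
    forall z, sub_incl _ (g z) = fst_col z & forall x, exists z, g z = x.
Proof.
have [g gP] : exists g : {linear R V i -> U V i.+1}, forall z,
    sub_incl _ (g z) = (fst \o sub_incl _) z.
  by apply: sub_factor => z; have [] := sub_inclP z.
exists g => // x; pose x' := sub_incl _ x; have sx : supported i.+1 x' := sub_inclP x.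
have [z zP] : exists z : R V i, sub_incl _ z = (x', column_at T (al i) (x' i)).
  apply: sub_lift; split=> //=; first exact: column_at_supported.
  by rewrite ffunE eqxx.
by exists z; apply: sub_incl_inj; rewrite gP; apply: (congr1 fst zP).
Qed.

(** Forgetting the second column, the kernel consists of the second columns whose
    shared diagonal entry, in row [al i], vanishes. *)
Lemma short_exact_Umod (i : 'I_n) : short_exact (U V (al i)) (R V i) (U V i.+1).
Proof.
have [f fP] : exists f : {linear U V (al i) -> R V i}, forall x,
    sub_incl _ (f x) = (lin_map (@inr_linear A (columns T V) (columns T V)) \o sub_incl _) x.
  apply: sub_factor => x /=; have sx := sub_inclP x.
  split=> /= [j _|j ij|]; rewrite ?col_zeroE //; first by rewrite sx // ltnW.
  by rewrite sx.
have [g gP surj_g] := Rmod_to_Umod i.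
exists f, g; split=> [x y e|//|z].
- apply: sub_incl_inj; have := fP x; rewrite e fP /=; by case.
- have [z1 z2 ez] := sub_inclP z; split=> [gz|[x <-]]; last first.
    by apply: sub_incl_inj; rewrite gP linear0; apply: (congr1 fst (fP x)).
  have z10 : (sub_incl _ z).1 = 0 by have := gP z; rewrite gz linear0.
  have [x xP] : exists x : U V (al i), sub_incl _ x = (sub_incl _ z).2.
    apply: sub_lift => j; rewrite leq_eqVlt => /orP[/eqP/val_inj<-|]; last exact: z2.
    by rewrite -ez z10 col_zeroE.
  exists x; apply: sub_incl_inj; rewrite fP.
  by rewrite [RHS]surjective_pairing; congr pair.
Qed.

End Syzygies.

(** The same group as [M], under another name to carry the action of [k]. *)
Definition restrict_scalars (M : lmodType A) : Type := M.
HB.instance Definition _ (M : lmodType A) :=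
  GRing.Zmodule.copy (restrict_scalars M) M.

Section RestrictScalars.
Variable M : lmodType A.
Definition rs_scale (c : k) (x : restrict_scalars M) : restrict_scalars M :=
  c%:A *: (x : M).

Let scaleA c d x : rs_scale c (rs_scale d x) = rs_scale (c * d) x.
Proof. exact: alg_scale_scale. Qed.
Let scale1 : left_id 1 rs_scale.
Proof. by move=> x; rewrite /rs_scale !scale1r. Qed.
Let scaleDr : right_distributive rs_scale +%R.
Proof. by move=> c x y; rewrite /rs_scale scalerDr. Qed.
Let scaleDl x : {morph rs_scale^~ x : c d / c + d}.
Proof. by move=> c d; rewrite /rs_scale !scalerDl. Qed.
HB.instance Definition _ :=
  GRing.Zmodule_isLmodule.Build k (restrict_scalars M) scaleA scale1 scaleDr scaleDl.

Lemma rs_scaleE c (x : restrict_scalars M) : c *: x = c%:A *: (x : M).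
Proof. by []. Qed.
End RestrictScalars.

(** Such a module is the simple module at the vertex of [i] tensored with a vector
    space. *)
Definition diagonal_module (i : 'I_n) (M : lmodType A) : Prop :=
  forall a (x : M), a *: x = (mx a i i)%:A *: x.

(** The kernel of the shared diagonal entry of the two columns: they vanish from rows
    [i] and [al i] on, independently of each other. *)
Lemma short_exact_diagonal (i : 'I_n) (M : lmodType A) : diagonal_module i M ->
  short_exact (U (restrict_scalars M) i * U (restrict_scalars M) (al i))%type
              (R (restrict_scalars M) i) M.
Proof.
move=> diagM; set V := restrict_scalars M.
have lg : linear (fun z : R V i => (fst_col z i : M)).
  move=> a z z'; rewrite fst_colD diagM; congr (_ + _).
  have [z1 _ _] := sub_inclP z.
  by rewrite /fst_col linearZ_LR -rs_scaleE -supported_scaleE.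
have [f fP] : exists f : {linear (U V i * U V (al i))%type -> R V i}, forall x,
    sub_incl _ (f x) = (lin_map (pair_map_linear (sub_incl _ \o fst) (sub_incl _ \o snd))) x.
  apply: sub_factor => -[x y] /=; have sx := sub_inclP x; have sy := sub_inclP y.
  split=> /= [j ij|j ij|]; rewrite ?sx ?sy // ltnW //.
exists f, (lin_map lg); split=> [x y e|x|z].
- have := fP x; rewrite e fP; case: x y {e} => x1 x2 [y1 y2] /= [].
  by move=> /sub_incl_inj-> /sub_incl_inj->.
- exists (generator T i (x : V)); rewrite /= /fst_col generatorE //=.
  by rewrite ffunE eqxx.
- have [z1 z2 ez] := sub_inclP z; split=> [gz|[[x y] <-]]; last first.
    by rewrite /= /fst_col fP /= (sub_inclP x).
  have [x xP] : exists x : U V i, sub_incl _ x = fst_col z.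
    apply: sub_lift => j; rewrite leq_eqVlt => /orP[/eqP/val_inj<-|]; last exact: z1.
    exact: gz.
  have [y yP] : exists y : U V (al i), sub_incl _ y = snd_col z.
    apply: sub_lift => j; rewrite leq_eqVlt => /orP[/eqP/val_inj<-|]; last exact: z2.
    by rewrite -[LHS]ez; exact: gz.
  exists (x, y); apply: sub_incl_inj; rewrite fP.
  by rewrite [RHS]surjective_pairing; congr pair.
Qed.
End ColumnSyzygies.

Section SyzygyCounting.
Variables (k : fieldType) (n : nat) (al : 'S_n) (A : algType k).
Variable T : triangular_model al A.
Hypothesis alK : forall i, al (al i) = i.
Hypothesis al_neq : forall i, al i <> i.
Variable tau : 'I_n -> 'I_n.
Hypothesis tauS : forall i, (0 < al i)%N -> (tau i).+1 = al i.
Local Notation mx a := (entries T a).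
Local Notation U V j := (Umod T V j).
Local Notation R V i := (Rmod T V i).

(** Each step of [tau] is a syzygy; it ends with the kernel [U V 0]. *)
Lemma pd_lt_Umod V t (i : 'I_n) :
  al (iter t tau i) = 0%N :> nat -> pd_lt t.+1 (U V i.+1).
Proof.
elim: t i => [|t IH] i ali.
  exists (U V (al i)), (R V i); split; [exact: Rmod_projective|exact: short_exact_Umod|].
  by rewrite [X in U V X]ali; apply: Umod_zero.
have pd_al : pd_lt t.+1 (U V (al i)).
  have [ali0|/tauS e] := posnP (al i).
    by rewrite ali0; apply: pd_lt0; apply: Umod_zero.
  by rewrite -e; apply: IH; rewrite -iterSr.
exists (U V (al i)), (R V i); split; [exact: Rmod_projective|exact: short_exact_Umod|].
exact: pd_al.
Qed.

Section UpperBound.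
Hypothesis reach0 : forall i : 'I_n, (i.+1 < n)%N ->
  exists2 t, (t.+1 < n)%N & al (iter t tau i) = 0%N :> nat.

Lemma pd_lt_Umod_maximal V j : (j < n)%N -> pd_lt n.-1 (U V j).
Proof.
case: j => [|j] jn; first by apply: pd_lt0; apply: Umod_zero.
have [t tn talj] := reach0 (i := Ordinal (ltnW jn)) jn.
apply: (@pd_lt_leq _ t.+1); first by case: (n) tn.
exact: pd_lt_Umod talj.
Qed.

Lemma pd_lt_diagonal (i : 'I_n) (M : lmodType A) :
  diagonal_module T i M -> pd_lt n M.
Proof.
move=> /short_exact_diagonal; set V := restrict_scalars M => sM.
have n0 : (0 < n)%N by exact: leq_ltn_trans (leq0n i) (ltn_ord i).
rewrite -(prednK n0); exists (U V i * U V (al i))%type, (R V i).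
split=> //; first exact: Rmod_projective.
by apply: pd_lt_short_exact (short_exact_split _ _) _ _; apply: pd_lt_Umod_maximal.
Qed.

(** The elements of [A] whose matrices vanish from row [s] on form a left ideal;
    multiplying [M] by these ideals filters it, with diagonal modules as layers. *)
Definition row_filtration (M : lmodType A) (s : nat) (x : M) : Prop :=
  exists2 l : seq (A * M),
    forall p, p \in l -> forall r c : 'I_n, (s <= r)%N -> mx p.1 r c = 0
    & x = \sum_(p <- l) p.1 *: p.2.

Lemma row_filtration_submodule (M : lmodType A) s :
  submodule_of (@row_filtration M s).
Proof.
split; first by exists [::]; rewrite ?big_nil.
move=> a x y [lx hx ->] [ly hy ->].
exists ([seq (a * p.1, p.2) | p <- lx] ++ ly).
  move=> p; rewrite mem_cat => /orP[/mapP[q qx ->] r c sr|/hy//].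
  rewrite entriesM mxE big1 // => j _.
  have [jr|rj] := ltnP j r; first by rewrite entries_lower ?mul0r.
  by rewrite (hx _ qx) ?mulr0 // (leq_trans sr).
rewrite big_cat big_map scaler_sumr; congr (_ + _).
by apply: eq_bigr => p _; rewrite scalerA.
Qed.

Definition row_layer (M : lmodType A) s : lmodType A :=
  submod (row_filtration_submodule M s).

Lemma row_filtrationS (M : lmodType A) s (x : M) :
  row_filtration s x -> row_filtration s.+1 x.
Proof. by move=> [l hl ->]; exists l => // p /hl h r c /ltnW/h. Qed.

Lemma row_filtration0 (M : lmodType A) (x : M) : row_filtration 0 x -> x = 0.
Proof.
move=> [l hl ->]; rewrite big_seq big1 // => p /hl h.
have -> : p.1 = 0 by apply: (entries_inj (t := T)); apply/matrixP => r c; rewrite entries0 mxE h.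
by rewrite scale0r.
Qed.

Lemma row_filtration_full (M : lmodType A) (x : M) : row_filtration n x.
Proof.
exists [:: (1, x)]; last by rewrite big_seq1 scale1r.
by move=> p _ r c; rewrite leqNgt ltn_ord.
Qed.

(** By triangularity, left multiplication by [a - (mx a i i)%:A] takes the matrices that
    vanish below row [i] to matrices that vanish from row [i] on. *)
Lemma row_filtration_diagonal (M : lmodType A) (i : 'I_n) a (x : M) :
  row_filtration i.+1 x -> row_filtration i (a *: x - (mx a i i)%:A *: x).
Proof.
move=> [l hl ->]; exists [seq ((a - (mx a i i)%:A) * p.1, p.2) | p <- l]; last first.
  rewrite big_map -scalerBl scaler_sumr.
  by apply: eq_bigr => p _; rewrite scalerA.
move=> _ /mapP[p pl ->] r c ir /=; rewrite entriesM mxE big1 // => j _.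
have [lt_ij|le_ji] := ltnP i j; first by rewrite (hl _ pl) ?mulr0.
have -> : mx (a - (mx a i i)%:A) r j = mx a r j - (mx a i i) *+ (r == j).
  by rewrite -scaleN1r entriesD entriesZ entries_alg !mxE mulN1r.
have [e|rj] := eqVneq r j; last first.
  rewrite subr0 entries_lower ?mul0r // ltn_neqAle eq_sym rj /=.
  exact: leq_trans ir.
have ri : r = i by apply/val_inj/eqP; rewrite eqn_leq ir e le_ji.
by rewrite -e ri subrr mul0r.
Qed.

Lemma pd_lt_row_layer (M : lmodType A) s : (s <= n)%N -> pd_lt n (row_layer M s).
Proof.
elim: s => [|s IH] sn.
  apply: pd_lt0 => x; apply: sub_incl_inj; rewrite linear0.
  exact: row_filtration0 (sub_inclP x).
pose i := Ordinal sn; pose N := row_layer M s.+1.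
pose S (x : N) := row_filtration s (sub_incl _ x).
have hS : submodule_of S.
  split=> [|a x y Sx Sy]; rewrite /S ?linear0 ?linearP.
    exact: (row_filtration_submodule M s).1.
  exact: (row_filtration_submodule M s).2.
apply: (@pd_lt_short_exact _ _ (row_layer M s) _ (quomod hS)).
- have [f fP] : exists f : {linear row_layer M s -> N}, forall x,
      sub_incl _ (f x) = sub_incl _ x.
    apply: (@sub_factor _ _ _ (row_filtration_submodule M s.+1) _
      (sub_incl (row_filtration_submodule M s))) => x.
    exact: row_filtrationS (sub_inclP x).
  exists f, (quo_map hS); split=> [x y e|q|x].
  + by apply: sub_incl_inj; rewrite -!fP e.
  + exact: quo_map_surj.
  + rewrite quo_map_eq0; split=> [Sx|[y <-]]; last by rewrite /S fP; apply: sub_inclP.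
    have [y yP] : exists y : row_layer M s, sub_incl _ y = sub_incl _ x by apply: sub_lift.
    by exists y; apply: sub_incl_inj; rewrite fP.
- exact/IH/ltnW.
- apply: (@pd_lt_diagonal i) => a q; have [x <-] := quo_map_surj q.
  rewrite -!linearZ /=; apply/quo_pi_eq; rewrite /S.
  have -> : sub_incl (row_filtration_submodule M s.+1) (a *: x - (mx a i i)%:A *: x)
      = a *: sub_incl _ x - (mx a i i)%:A *: sub_incl _ x.
    by rewrite linearB; congr (_ - _); rewrite linearZ_LR.
  exact: (@row_filtration_diagonal M i a _ (sub_inclP x)).
Qed.

Lemma pd_lt_all (M : lmodType A) : pd_lt n M.
Proof.
apply: (@pd_lt_short_exact _ _ (row_layer M n) _ (row_layer M 0)).
- exists (sub_incl _), \0; split=> [|y|x]; first exact: sub_incl_inj.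
    exists 0; apply: sub_incl_inj; rewrite linear0.
    exact/esym/row_filtration0/(sub_inclP y).
  by split=> // _; apply/sub_lift/row_filtration_full.
- exact: pd_lt_row_layer.
- exact: pd_lt_row_layer.
Qed.

End UpperBound.

(** A splitting of the surjection [R_i -> U_{i+1}] would send the top basis vector
    of [U_{i+1}] to a generator of [R_i]; but the matrix unit in position
    [(al i - 1, al i)] kills the former and not the latter. *)
Lemma projective_Umod_zero (i : 'I_n) : projective (U k^o i.+1) -> al i = 0%N :> nat.
Proof.
move=> pU; apply/eqP; rewrite -leqn0 leqNgt; apply/negP => al0.
have [g gP surj_g] := Rmod_to_Umod T k^o i.
have [h hP] := pU _ _ g idfun surj_g.
have [x xP] : exists x : U k^o i.+1, sub_incl _ x = column_at T i (1 : k^o).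
  exact/sub_lift/column_at_supported.
have [z1 z2 ez] := sub_inclP (h x).
have z1x : fst_col (h x) = column_at T i (1 : k^o) by rewrite -gP hP.
have z2x : snd_col (h x) (al i) = 1.
  by rewrite -[LHS]ez -/(fst_col _) z1x ffunE eqxx.
pose l := tau i; have lP : l.+1 = al i by exact: tauS.
pose a := right_elt T i l.
have ax : a *: x = 0.
  apply: sub_incl_inj; rewrite linear0 linearZ_LR xP; apply/ffunP => r.
  by rewrite column_at_scaleE right_elt_col // scale0r col_zeroE.
have /eqP := oner_neq0 k; apply.
have : snd_col (h (a *: x)) l = 0 by rewrite ax linear0 snd_col0.
rewrite linearZ_LR /snd_col linearZ_LR -/(snd_col _) [LHS]col_scaleE.
rewrite (bigD1 (al i)) //= big1 ?addr0 => [|j /negPf jal].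
  by rewrite right_elt_colC eqxx -lP ltnSn /= z2x scale1r.
by rewrite right_eltE jal scale0r.
Qed.

(** As long as the orbit of [i] under [tau] has not reached a zero of [al], the
    modules [U_{tau^t i + 1}] are successive syzygies of [U_{i+1}]. *)
Lemma pd_lt_reaches_zero d (i : 'I_n) : pd_lt d.+1 (U k^o i.+1) ->
  exists2 t, (t <= d)%N & al (iter t tau i) = 0%N :> nat.
Proof.
move=> pdU; apply: contrapT => nz.
have al_pos t : (t <= d)%N -> (0 < al (iter t tau i))%N.
  by move=> td; rewrite lt0n; apply/eqP => e; apply: nz; exists t.
have pR t : projective (R k^o (iter t tau i)) by exact: Rmod_projective.
have := projective_nth_syzygy (X := fun t => U k^o (iter t tau i).+1)
  (R := fun t => R k^o (iter t tau i)) pR _ pdU.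
move=> pX; have /projective_Umod_zero e : projective (U k^o (iter d tau i).+1).
  apply: pX => t td /=; rewrite tauS; last exact/al_pos/ltnW.
  exact: short_exact_Umod.
by have := al_pos d (leqnn d); rewrite e.
Qed.
End SyzygyCounting.

(** * Cutting paths, and products in the path algebra *)

Section PathCuts.
Variable Q : quiver.
Implicit Types (p q r : qpath Q) (v : vertex Q).

Lemma qpath_eq p q :
  path_source p = path_source q -> path_arrows p = path_arrows q -> p = q.
Proof.
move=> es ea; apply: val_inj; rewrite /= (surjective_pairing (path_val p)).
by rewrite (surjective_pairing (path_val q)); congr pair.
Qed.

Fact path_take_subproof q s : walk (path_source q) (take s (path_arrows q)).
Proof. by have := path_valP q; rewrite -[(path_val q).2](cat_take_drop s) walk_cat => /andP[]. Qed.

Definition path_take q s : qpath Q :=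
  @QPath _ (path_source q, take s (path_arrows q)) (path_take_subproof q s).

Fact path_drop_subproof q s :
  walk (path_target (path_take q s)) (drop s (path_arrows q)).
Proof. by have := path_valP q; rewrite -[(path_val q).2](cat_take_drop s) walk_cat => /andP[]. Qed.

Definition path_drop q s : qpath Q :=
  @QPath _ (path_target (path_take q s), drop s (path_arrows q)) (path_drop_subproof q s).

Lemma path_arrows_take q s : path_arrows (path_take q s) = take s (path_arrows q).
Proof. by []. Qed.

Lemma path_arrows_drop q s : path_arrows (path_drop q s) = drop s (path_arrows q).
Proof. by []. Qed.

Lemma path_take_drop q s : path_cat (path_take q s) (path_drop q s) = Some q.
Proof.
have e : path_target (path_take q s) = path_source (path_drop q s) by [].
rewrite (path_catE e); congr Some; apply: qpath_eq => //.
exact: cat_take_drop.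
Qed.

Lemma path_catK p q r : path_cat p q = Some r ->
  [/\ (path_length p <= path_length r)%N, p = path_take r (path_length p)
    & q = path_drop r (path_length p)].
Proof.
have [e|/eqP n] := eqVneq (path_target p) (path_source q); last by rewrite path_cat_None.
rewrite (path_catE e) => -[<-].
have pe : p = path_take (path_join e) (path_length p).
  by apply: qpath_eq => //; rewrite /path_arrows /= take_size_cat.
split=> //; first by rewrite /path_length /path_arrows /= size_cat leq_addr.
apply: qpath_eq; first by rewrite /path_source /= -pe e.
by rewrite /path_arrows /= drop_size_cat.
Qed.

Lemma path_length_take q s : (s <= path_length q)%N -> path_length (path_take q s) = s.
Proof. by move=> sq; rewrite /path_length size_takel. Qed.

Lemma path_take_size q : path_take q (path_length q) = q.
Proof. by apply: qpath_eq => //; rewrite /path_arrows /= take_size. Qed.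

Lemma path_drop0 q : path_drop q 0 = q.
Proof.
apply: qpath_eq; last exact: drop0.
by rewrite [LHS]/path_source /= /path_target /path_arrows /= take0.
Qed.

Definition path_part q l c := path_drop (path_take q c) l.

Lemma path_arrows_part q l c :
  path_arrows (path_part q l c) = drop l (take c (path_arrows q)).
Proof. by []. Qed.

Lemma path_take_take q l c : (l <= c)%N -> path_take (path_take q c) l = path_take q l.
Proof. by move=> lc; apply: qpath_eq => //; apply: take_takel. Qed.

Lemma path_source_part q l c : (l <= c)%N ->
  path_source (path_part q l c) = path_target (path_take q l).
Proof. by move=> lc; rewrite -(path_take_take q lc). Qed.

Lemma path_length_part q l c : (c <= path_length q)%N ->
  path_length (path_part q l c) = (c - l)%N.
Proof. by move=> cq; rewrite /path_length path_arrows_part size_drop size_takel. Qed.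

Lemma path_take_part q (l r c : nat) : (l <= r)%N -> (r <= c)%N ->
  path_take (path_part q l c) (r - l) = path_part q l r.
Proof.
move=> lr rc; apply: qpath_eq.
  by rewrite path_source_part // -(path_source_part q (leq_trans lr rc)).
rewrite [LHS]/path_arrows /= !path_arrows_part take_drop subnK //.
by rewrite take_takel.
Qed.

Lemma path_drop_part q (l r c : nat) : (l <= r)%N -> (r <= c)%N -> (c <= path_length q)%N ->
  path_drop (path_part q l c) (r - l) = path_part q r c.
Proof.
move=> lr rc cq; apply: qpath_eq; last first.
  by rewrite [LHS]/path_arrows /= !path_arrows_part drop_drop subnK.
rewrite path_source_part // [LHS]/path_source /= path_take_part //.
rewrite /path_target path_source_part // path_arrows_part.
rewrite -[in RHS](cat_take_drop l (path_arrows (path_take q r))).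
rewrite map_cat last_cat; congr (last _ _).
by rewrite /path_target /path_source /path_arrows /= take_takel.
Qed.

Lemma path_target_take v0 q l : (l <= path_length q)%N ->
  path_target (path_take q l) = nth v0 (path_vertices q) l.
Proof.
have gen s v : (l <= size s)%N ->
    last v [seq target a | a <- take l s] = nth v0 (v :: [seq target a | a <- s]) l.
  by elim: s v l => [|a s IH] v [|l] //= /IH.
exact: gen.
Qed.

End PathCuts.

Section PathProducts.
Variables (k : comNzRingType) (Q : quiver).
Implicit Types (x y : path_algebra k Q) (p q r : qpath Q).

(** A path is the concatenation of [p] and [q] in at most one way, the cut being at the
    length of [p]. *)
Lemma coef_cat p q r : coef (of_path_cat k p q) r =
  \sum_(s < (path_length r).+1) (p == path_take r s)%:R * (q == path_drop r s)%:R.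
Proof.
have [e|ne] := eqVneq (path_cat p q) (Some r).
  have [pr pE qE] := path_catK e; rewrite /of_path_cat e coef_of_path eqxx.
  rewrite (bigD1 (Ordinal (pr : (path_length p < (path_length r).+1)%N))) //=.
  rewrite -pE -qE !eqxx mulr1 big1 ?addr0 // => s /eqP sp.
  have [pe|] := eqVneq p (path_take r s); last by rewrite mul0r.
  case: sp; apply: val_inj => /=; rewrite [in RHS]pe path_length_take //.
  by rewrite -ltnS ltn_ord.
rewrite big1 => [|s _]; last first.
  have [pe|] := eqVneq p (path_take r s); last by rewrite mul0r.
  have [qe|] := eqVneq q (path_drop r s); last by rewrite mulr0.
  by rewrite pe qe path_take_drop eqxx in ne.
rewrite /of_path_cat; case: (path_cat p q) ne => [t|]; last by rewrite Defs.coef0.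
by rewrite coef_of_path => /eqP ne; case: eqP => // e; case: ne; rewrite e.
Qed.

Lemma coef_expand x r : coef x r = \sum_(p <- path_supp x) coef x p * (p == r)%:R.
Proof.
rewrite [in LHS](path_algebraE x) Defs.coef_sum.
by apply: eq_bigr => p _; rewrite Defs.coefZ coef_of_path.
Qed.

Lemma coef_path_mul x y r : coef (x * y) r =
  \sum_(s < (path_length r).+1) coef x (path_take r s) * coef y (path_drop r s).
Proof.
have lin : coef (x * y) r = \sum_(p <- path_supp x) \sum_(q <- path_supp y)
    (coef x p * coef y q) * coef (of_path_cat k p q) r.
  rewrite {1}(path_algebraE x) mulr_suml Defs.coef_sum; apply: eq_bigr => p _.
  rewrite {1}(path_algebraE y) mulr_sumr Defs.coef_sum; apply: eq_bigr => q _.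
  by rewrite -pa_scalerAl -pa_scalerAr Defs.coefZ Defs.coefZ of_pathM mulrA.
rewrite lin.
transitivity (\sum_(p <- path_supp x) \sum_(s < (path_length r).+1)
   (coef x p * (p == path_take r s)%:R) * coef y (path_drop r s)).
  apply: eq_bigr => p _.
  transitivity (\sum_(s < (path_length r).+1) \sum_(q <- path_supp y)
    (coef x p * coef y q) * ((p == path_take r s)%:R * (q == path_drop r s)%:R)).
    by rewrite exchange_big; apply: eq_bigr => q _; rewrite coef_cat mulr_sumr.
  apply: eq_bigr => s _; rewrite [in RHS](coef_expand y) mulr_sumr.
  by apply: eq_bigr => q _; rewrite mulrACA.
rewrite exchange_big; apply: eq_bigr => s _.
by rewrite [in RHS](coef_expand x) mulr_suml.
Qed.

Lemma coef_path_one r : coef (1 : path_algebra k Q) r = (path_arrows r == [::])%:R.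
Proof.
rewrite -[1]/(pa_one k Q) /pa_one Defs.coef_sum.
have [e|ne] := eqVneq (path_arrows r) [::].
  rewrite (bigD1 (path_source r)) //= coef_of_path big1 ?addr0 => [|v vr].
    by rewrite (_ : _ == _) //; apply/eqP/qpath_eq; rewrite // e.
  rewrite coef_of_path; case: eqP => // e'; by rewrite -e' eqxx in vr.
rewrite big1 // => v _; rewrite coef_of_path; case: eqP => // e'.
by rewrite -e' eqxx in ne.
Qed.

End PathProducts.

(** * Nonzero paths and the ideal of relations *)

Section NonzeroPaths.
Variables (k : fieldType) (Q : bound_quiver).
Implicit Types (a b : arrow Q) (p q r : qpath Q) (x y : path_algebra k Q).
Local Notation in_ideal := (@in_ideal k Q).

Definition follows a b := (target a == source b) && ~~ relation a b.
Definition nonzero_path q := sorted follows (path_arrows q).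

Lemma nonzero_take q s : nonzero_path q -> nonzero_path (path_take q s).
Proof. exact: take_sorted. Qed.

Lemma nonzero_drop q s : nonzero_path q -> nonzero_path (path_drop q s).
Proof. exact: drop_sorted. Qed.

Lemma in_idealD x y : in_ideal x -> in_ideal y -> in_ideal (x + y).
Proof.
move=> [s1 h1 ->] [s2 h2 ->]; exists (s1 ++ s2); first by rewrite all_cat h1.
by rewrite big_cat.
Qed.

Lemma in_ideal0 : in_ideal 0.
Proof. by exists [::]; rewrite ?big_nil. Qed.

Lemma in_ideal_mull y x : in_ideal x -> in_ideal (y * x).
Proof.
move=> [s hs ->]; exists [seq (y * t.1.1, t.1.2, t.2) | t <- s].
  by rewrite all_map.
by rewrite big_map mulr_sumr; apply: eq_bigr => t _; rewrite !mulrA.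
Qed.

Lemma in_ideal_mulr y x : in_ideal x -> in_ideal (x * y).
Proof.
move=> [s hs ->]; exists [seq (t.1.1, t.1.2, t.2 * y) | t <- s].
  by rewrite all_map.
by rewrite big_map mulr_suml; apply: eq_bigr => t _; rewrite !mulrA.
Qed.

Lemma in_idealZ c x : in_ideal x -> in_ideal (c *: x).
Proof. by move=> hx; rewrite -[x]mul1r pa_scalerAl; apply: in_ideal_mull. Qed.

(** Each summand of [x] passes through a relation, whereas the pieces of [r] do not
    contain any. *)
Lemma coef_ideal_nonzero x r : in_ideal x -> nonzero_path r -> coef x r = 0.
Proof.
move=> [s /allP hs ->] gr; rewrite Defs.coef_sum big_seq big1 // => t /hs ht.
rewrite coef_path_mul big1 // => i _; rewrite coef_path_mul [X in X * _]big1 ?mul0r // => j _.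
have [q qa ->] := of_arrowM k (relation_path ht).
rewrite coef_of_path; case: eqP => [e|_]; rewrite ?mulr0 //.
have := nonzero_drop j (nonzero_take i gr); rewrite -e /nonzero_path qa /=.
by rewrite /follows ht !andbF.
Qed.

Lemma qpath_eq_arrows p q : path_arrows p != [::] ->
  path_arrows p = path_arrows q -> p = q.
Proof.
move=> n0 e; apply: qpath_eq => //; have := path_valP q; have := path_valP p.
rewrite -/(path_arrows p) -/(path_arrows q) -e -/(path_source p) -/(path_source q).
by case: (path_arrows p) n0 => //= a s _ /andP[/eqP<- _] /andP[/eqP<- _].
Qed.

Lemma path_length1 p : path_length p = 1%N -> exists a, p = arrow_path a.
Proof.
rewrite /path_length; case E: (path_arrows p) => [|a [|? ?]] //= _.
by exists a; apply: qpath_eq_arrows; rewrite E.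
Qed.

Lemma of_path_take_drop q s :
  of_path k q = of_path k (path_take q s) * of_path k (path_drop q s).
Proof. by rewrite of_pathM /of_path_cat path_take_drop. Qed.

Lemma unsorted_split (T : eqType) (e : rel T) (s : seq T) : ~~ sorted e s ->
  exists s1 u w s2, s = s1 ++ [:: u, w & s2] /\ ~~ e u w.
Proof.
elim: s => [|u [|w s] IH] //=; rewrite negb_and.
have [euw /= /IH[s1 [c [d [s2 [-> cd]]]]]|euw _] := boolP (e u w).
  by exists (u :: s1), c, d, s2.
by exists [::], u, w, s.
Qed.

Lemma walk_infix v (s1 : seq (arrow Q)) a b (s2 : seq (arrow Q)) :
  walk v (s1 ++ [:: a, b & s2]) -> target a = source b.
Proof. by rewrite walk_cat => /and4P[_ _ /eqP]. Qed.

Lemma zero_path_in_ideal q : ~~ nonzero_path q -> in_ideal (of_path k q).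
Proof.
move=> /unsorted_split[s1 [a [b [s2 [e nab]]]]].
have ab : target a = source b.
  by have := path_valP q; rewrite -/(path_arrows q) e => /walk_infix.
have rab : relation a b by move: nab; rewrite /follows ab eqxx negbK.
rewrite (of_path_take_drop q (size s1)); apply: in_ideal_mull.
rewrite (of_path_take_drop (path_drop q (size s1)) 2); apply: in_ideal_mulr.
have -> : of_path k (path_take (path_drop q (size s1)) 2) = of_arrow k a * of_arrow k b.
  have [r ra ->] := of_arrowM k ab; congr of_path; apply/esym/qpath_eq_arrows.
    by rewrite ra.
  by rewrite ra path_arrows_take path_arrows_drop e drop_size_cat //= take0.
by apply/in_ideal_path2.
Qed.

(** The ideal is monomial: membership is read off the coefficients of the paths
    without consecutive relation. *)
Lemma in_idealP x : in_ideal x <-> forall r, nonzero_path r -> coef x r = 0.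
Proof.
split=> [hx r|h]; first exact: coef_ideal_nonzero.
rewrite (path_algebraE x); elim/big_ind: _ => [||p _]; [exact: in_ideal0|exact: in_idealD|].
have [/h->|/zero_path_in_ideal hp] := boolP (nonzero_path p).
  by rewrite scale0r; apply: in_ideal0.
exact: in_idealZ.
Qed.

Lemma in_ideal_of_path q : in_ideal (of_path k q) <-> ~~ nonzero_path q.
Proof.
split=> [/in_idealP h|]; last exact: zero_path_in_ideal.
apply/negP => /h; rewrite coef_of_path eqxx => /eqP; apply/negP; exact: oner_neq0.
Qed.

Lemma in_ideal_of_path_cat p q : in_ideal (of_path k p * of_path k q) <->
  forall r, path_cat p q = Some r -> ~~ nonzero_path r.
Proof.
rewrite of_pathM /of_path_cat; case: (path_cat p q) => [t|].
  by rewrite in_ideal_of_path; split=> [h _ [<-]//|]; apply.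
by split=> // _; apply: in_ideal0.
Qed.

(** * Algebras with one maximal path *)

Definition subpath q p : Prop :=
  exists l c, [/\ (l <= c)%N, (c <= path_length p)%N & q = path_part p l c].

Lemma subpath_refl p : subpath p p.
Proof. by exists 0%N, (path_length p); rewrite /path_part path_drop0 path_take_size. Qed.

Lemma subpath_trans p q r : subpath p q -> subpath q r -> subpath p r.
Proof.
move=> [l [c [lc cq ->]]] [l' [c' [lc' cr qE]]].
rewrite qE path_length_part // in cq; rewrite qE.
have cc' : (l' + c <= c')%N by rewrite -leq_subRL.
exists (l' + l)%N, (l' + c)%N; split; [by rewrite leq_add2l|exact: leq_trans cr|].
rewrite {1}/path_part -[X in path_take _ X](addKn l' c) path_take_part ?leq_addr //.
rewrite -[X in path_drop _ X](addKn l' l) path_drop_part ?leq_addr ?leq_add2l //.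
exact: leq_trans cr.
Qed.

Lemma subpath_length q p : subpath q p -> (path_length q <= path_length p)%N.
Proof.
by move=> [l [c [lc cp ->]]]; rewrite path_length_part // (leq_trans (leq_subr _ _)).
Qed.

Lemma path_cat_length p q r : path_cat p q = Some r ->
  path_length r = (path_length p + path_length q)%N.
Proof.
have [e|/eqP n] := eqVneq (path_target p) (path_source q); last by rewrite path_cat_None.
by rewrite (path_catE e) => -[<-]; rewrite /path_length size_cat.
Qed.

Lemma subpath_catl p q r : path_cat p q = Some r -> subpath p r.
Proof.
move=> /path_catK[pr pE _]; exists 0%N, (path_length p); split=> //.
by rewrite /path_part path_drop0.
Qed.

Lemma subpath_catr p q r : path_cat p q = Some r -> subpath q r.
Proof.
move=> /path_catK[pr _ qE]; exists (path_length p), (path_length r); split=> //.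
by rewrite /path_part path_take_size.
Qed.

Lemma maximal_pathP q : maximal_path k q <-> nonzero_path q /\
  forall a r, path_cat q (arrow_path a) = Some r \/ path_cat (arrow_path a) q = Some r ->
    ~~ nonzero_path r.
Proof.
rewrite /maximal_path in_ideal_of_path; split=> [[/negP/negPn gq h]|[gq h]].
  split=> // a r [|]; have [] := h a; rewrite !in_ideal_of_path_cat => h1 h2; first exact: h1.
  exact: h2.
split=> [|a]; first by rewrite gq.
by rewrite !in_ideal_of_path_cat; split=> r hr; apply: (h a r); [left|right].
Qed.

(** The combinatorial form of having [p] as only maximal path; see
    [one_maximal_pathP]. *)
Definition dominates p : Prop :=
  nonzero_path p /\ forall q, nonzero_path q -> subpath q p.

(** A piece of [p] that does not start or end with [p] can be extended along [p]. *)
Lemma dominates_maximal p : dominates p -> forall q, maximal_path k q <-> q = p.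
Proof.
move=> [gp hp] q; rewrite maximal_pathP; split=> [[gq hq]|->]; last first.
  split=> // a r hr; apply/negP => /hp/subpath_length.
  by case: hr => /path_cat_length->; rewrite ?addn1 ?add1n ltnn.
have [l [c [lc cp qE]]] := hp q gq.
have cE : c = path_length p.
  apply/eqP; rewrite eqn_leq cp leqNgt /=; apply/negP => cp'.
  have [a aE] : exists a, path_part p c c.+1 = arrow_path a.
    by apply: path_length1; rewrite path_length_part // subSnn.
  have := hq a (path_part p l c.+1); rewrite (nonzero_drop _ (nonzero_take _ gp)) => /(_ _)/negP.
  apply=> //; left; rewrite -aE qE -(path_take_part p lc (leqnSn c)).
  by rewrite -(path_drop_part lc (leqnSn c) cp') path_take_drop.
have lE : l = 0%N.
  apply/eqP; rewrite -leqn0 leqNgt; apply/negP => l0.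
  have l1 : (l.-1 <= l)%N := leq_pred l.
  have [a aE] : exists a, path_part p l.-1 l = arrow_path a.
    apply: path_length1; rewrite path_length_part ?(leq_trans lc) //.
    by rewrite -[X in (X - _)%N](prednK l0) subSnn.
  have := hq a (path_part p l.-1 c); rewrite (nonzero_drop _ (nonzero_take _ gp)) => /(_ _)/negP.
  apply=> //; right; rewrite -aE qE -(path_take_part p l1 lc).
  by rewrite -(path_drop_part l1 lc cp) path_take_drop.
by rewrite qE cE lE /path_part path_drop0 path_take_size.
Qed.

Lemma dominates_findim p : dominates p -> quotient_findim k Q.
Proof.
move=> [gp hp]; pose n := (path_length p).+1.
pose l := undup [seq path_part p i j | i <- iota 0 n, j <- iota 0 n].
have ml q : nonzero_path q -> q \in l.
  move=> /hp[i [j [ij jp ->]]]; rewrite mem_undup; apply: allpairs_f;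
  by rewrite mem_iota ?add0n ltnS // (leq_trans ij).
exists [seq of_path k q | q <- l] => x.
exists (fun i => coef x (nth p l i)); apply/in_idealP => r gr.
rewrite Defs.coefD -scaleN1r Defs.coefZ Defs.coef_sum mulN1r; apply/eqP; rewrite subr_eq0; apply/eqP.
have rl := ml r gr.
have ir : (index r l < size [seq of_path k q | q <- l])%N by rewrite size_map index_mem.
rewrite (bigD1 (Ordinal ir)) //= big1 ?addr0 => [|i ni].
  by rewrite Defs.coefZ (nth_map p) ?index_mem // coef_of_path nth_index // eqxx mulr1.
have il : (i < size l)%N by rewrite -[X in (_ < X)%N](size_map (of_path k)) ltn_ord.
rewrite Defs.coefZ (nth_map p) // coef_of_path; case: eqP => [e|_]; rewrite ?mulr0 //.
case/eqP: ni; apply: val_inj => /=.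
by rewrite -e index_uniq ?undup_uniq.
Qed.

(** The initial pieces of a nonzero path are linearly independent modulo the ideal. *)
Lemma findim_bounded : quotient_findim k Q ->
  exists N, forall q, nonzero_path q -> (path_length q < N)%N.
Proof.
move=> [s hs]; exists (size s) => q gq; rewrite ltnNge; apply/negP => sq.
have /choice[c hc] : forall i : 'I_(size s).+1, exists c : 'I_(size s) -> k,
    in_ideal (of_path k (path_take q i) - \sum_j c j *: s`_j).
  by move=> i; apply: hs.
pose C := \matrix_(i < (size s).+1, j < size s) c i j.
have [v v0 vC] : exists2 v : 'rV[k]_(size s).+1, v != 0 & v *m C = 0.
  have /rowV0Pn[v vk v0] : kermx C != 0.
    rewrite -mxrank_eq0 mxrank_ker subn_eq0 -ltnNge.
    exact: leq_ltn_trans (rank_leq_col C) _.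
  by exists v => //; apply/sub_kermxP.
have {}vC : in_ideal (\sum_i v 0 i *: of_path k (path_take q i)).
  have -> : \sum_i v 0 i *: of_path k (path_take q i) =
     \sum_i v 0 i *: (of_path k (path_take q i) - \sum_j c i j *: s`_j).
    under [RHS]eq_bigr => i _ do rewrite scalerBr.
    rewrite sumrB [X in _ - X](_ : _ = 0) ?subr0 //.
    under eq_bigr => i _ do rewrite scaler_sumr.
    rewrite exchange_big big1 // => j _.
    have /rowP/(_ j) := vC; rewrite !mxE => e.
    rewrite -[RHS](scale0r (s`_j)) -e scaler_suml; apply: eq_bigr => i _.
    by rewrite scalerA mxE.
  elim/big_ind: _ => [||i _]; [exact: in_ideal0|exact: in_idealD|exact: in_idealZ].
case/eqP: v0; apply/rowP => i; rewrite mxE.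
have := coef_ideal_nonzero vC (nonzero_take i gq); rewrite Defs.coef_sum.
rewrite (bigD1 i) //= Defs.coefZ coef_of_path eqxx mulr1 big1 ?addr0 // => j ji.
rewrite Defs.coefZ coef_of_path; case: eqP => [e|_]; rewrite ?mulr0 //.
case/eqP: ji; apply: val_inj => /=.
have le (t : 'I_(size s).+1) : (t <= path_length q)%N.
  by rewrite (leq_trans _ sq) // -ltnS ltn_ord.
by rewrite -(path_length_take (le j)) e path_length_take.
Qed.

(** As lengths are bounded, every nonzero path extends to a maximal one. *)
Lemma maximal_dominates p : quotient_findim k Q ->
  (forall q, maximal_path k q <-> q = p) -> dominates p.
Proof.
move=> /findim_bounded[N hN] hp; split.
  by have /hp/maximal_pathP[] : p = p by [].
move=> q gq; have [d dE] : exists d, d = (N - path_length q)%N by exists (N - path_length q)%N.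
elim: d q gq dE => [|d IH] q gq dE.
  by have := hN q gq; rewrite -subn_gt0 -dE.
have [/hp->|nmax] := pselect (maximal_path k q); first exact: subpath_refl.
have [r [gr qr lr]] : exists r, [/\ nonzero_path r, subpath q r &
    path_length r = (path_length q).+1].
  apply: contrapT => nr; apply: nmax; apply/maximal_pathP; split=> // a r hr.
  apply/negP => gr; apply: nr; exists r; split=> //.
    by case: hr => [/subpath_catl|/subpath_catr].
  by case: hr => /path_cat_length->; rewrite ?addn1 ?add1n.
by apply: (subpath_trans qr); apply: IH => //; rewrite lr subnS -dE.
Qed.

Lemma one_maximal_pathP n (al : 'S_n) : gentle_one_maximal_path k Q al <->
  locally_gentle k Q /\ exists2 p : qpath Q, dominates p & associated_perm p al.
Proof.
split=> [[[lg fd] [p hp ap]]|[lg [p dp ap]]].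
  by split=> //; exists p => //; apply: maximal_dominates.
split; first by split=> //; apply: dominates_findim dp.
by exists p => //; apply: dominates_maximal.
Qed.

End NonzeroPaths.

(** * Arrows and vertices of the maximal path *)

Section DominatingPath.
Variable Q : bound_quiver.
Implicit Types (a b : arrow Q) (q : qpath Q).

Lemma follows_walk a (s : seq (arrow Q)) : path (@follows Q) a s -> walk (target a) s.
Proof.
elim: s a => //= b s IH a /andP[/andP[/eqP-> _] /IH->].
by rewrite eqxx.
Qed.

Lemma sorted_nonzero_path (s : seq (arrow Q)) : s != [::] -> sorted (@follows Q) s ->
  exists2 q : qpath Q, nonzero_path q & path_arrows q = s.
Proof.
case: s => // a s _ hs.
have w : walk (source a) (a :: s) by rewrite /= eqxx follows_walk.
by exists (@QPath _ (source a, a :: s) w).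
Qed.

Variable p : qpath Q.
Hypothesis dom_p : dominates p.
Local Notation ar := (path_arrows p).
Local Notation vx i := (nth (path_source p) (path_vertices p) i).

Lemma mem_dominating a : a \in ar.
Proof.
have [l [c [_ _ e]]] := dom_p.2 (arrow_path a) isT.
have := congr1 (@path_arrows Q) e; rewrite path_arrows_part => e'.
by apply/(mem_take (n0 := c))/(mem_drop (n0 := l)); rewrite -e' mem_head.
Qed.

Lemma not_uniq_split (T : eqType) (s : seq T) : ~~ uniq s ->
  exists s1 x s2 s3, s = s1 ++ x :: s2 ++ x :: s3.
Proof.
elim: s => //= x s IH; rewrite negb_and negbK => /orP[xs|/IH].
  by exists [::], x; case/splitPr: xs => s2 s3; exists s2, s3.
by move=> [s1 [y [s2 [s3 ->]]]]; exists (x :: s1), y, s2, s3.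
Qed.

(** A repeated arrow would make a longer nonzero path, by running twice through
    the arrows between its two occurrences. *)
Lemma uniq_dominating : uniq ar.
Proof.
apply: contraT => /not_uniq_split[s1 [x [s2 [s3 e]]]].
have [sp dom] := dom_p.
move: sp; rewrite /nonzero_path e sorted_cat_cons => /andP[h1 h2].
have [|//|q hq qE] := @sorted_nonzero_path (s1 ++ x :: s2 ++ x :: s2 ++ x :: s3).
- by case: (s1).
- rewrite sorted_cat_cons h1 cat_path /= h2 andbT.
  by move: h2; rewrite cat_path /= => /and3P[-> -> _].
have := subpath_length (dom _ hq).
rewrite /path_length qE e !size_cat /= !size_cat /= !addnS !ltnS !leq_add2l.
by rewrite size_cat /= addnS ltnNge leq_addl.
Qed.

(** A nonzero path of length two is a piece of [p], where each arrow occurs once. *)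
Lemma follows_dominating a b : follows a b <-> index b ar = (index a ar).+1.
Proof.
split=> [ab|e]; last first.
  have bs : ((index a ar).+1 < size ar)%N by rewrite -e index_mem mem_dominating.
  have /(sortedP a)/(_ _ bs) := dom_p.1.
  by rewrite -e !nth_index ?mem_dominating.
have [//||q hq qE] := @sorted_nonzero_path [:: a; b]; first by rewrite /= ab.
have [l [c [_ _ e]]] := dom_p.2 q hq.
move: qE; rewrite e path_arrows_part => e2.
have [s1 [s3 arE]] : exists s1 s3, ar = s1 ++ [:: a, b & s3].
  exists (take l (take c ar)), (drop c ar).
  by rewrite -[LHS](cat_take_drop c) -[X in X ++ _](cat_take_drop l) e2 -catA.
have := uniq_dominating; rewrite arE cat_uniq => /and3P[_ /hasPn h /=].
rewrite inE negb_or => /and3P[/andP[ab' _] _ _].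
have /negPf nb : b \notin s1 by apply: (h b); rewrite !inE eqxx orbT.
have /negPf na : a \notin s1 by apply: (h a); rewrite inE eqxx.
by rewrite !index_cat nb na /= !eqxx (negPf ab') addn1 addn0.
Qed.

Lemma source_dominating a : source a = vx (index a ar).
Proof.
have gen s v : walk v s -> a \in s -> source a = nth (path_source p) (v :: [seq target b | b <- s]) (index a s).
  elim: s v => //= b s IH v /andP[/eqP sb ws]; rewrite inE eq_sym.
  have [<-|ba] := eqVneq b a; first by rewrite sb.
  by move=> /= /(IH _ ws).
exact: gen (path_valP p) (mem_dominating a).
Qed.

Lemma target_dominating a : target a = vx (index a ar).+1.
Proof.
rewrite /path_vertices /= (nth_map a) ?index_mem ?mem_dominating //.
by rewrite nth_index ?mem_dominating.
Qed.

Lemma size_path_vertices : size (path_vertices p) = (path_length p).+1.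
Proof. by rewrite /path_vertices /= size_map. Qed.

Lemma vertex_dominating v : exists2 i, (i < (path_length p).+1)%N & v = vx i.
Proof.
have [l [c [lc cp e]]] := dom_p.2 (trivial_path v) isT.
have lp := leq_trans lc cp; exists l => //.
have := congr1 (@path_source Q) e; rewrite path_source_part //.
by rewrite (path_target_take (path_source p)).
Qed.

Variable al : 'S_(path_length p).+1.
Hypothesis al_assoc : associated_perm p al.
Hypothesis al_chord : chord_diagram al.

Lemma vertex_eq (i j : 'I_(path_length p).+1) : vx i = vx j <-> j = i \/ j = al i.
Proof.
have [_ h] := al_assoc; have [h1 h2] := h i; split=> [e|[->//|->]].
  by have [->|ji] := eqVneq j i; [left|right; rewrite -(h1 j)].
apply: contrapT => ne; have [_ /(_ i)] := al_chord; apply; apply: h2 => l li e.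
by apply: ne; rewrite (h1 l li e) e.
Qed.
End DominatingPath.

(** * The algebra as a matrix algebra *)

Section TriangularPresentation.
Variables (k : fieldType) (Q : bound_quiver) (p : qpath Q).
Hypothesis dom_p : dominates p.
Local Notation n := (path_length p).+1.
Variable al : 'S_n.
Hypothesis al_assoc : associated_perm p al.
Hypothesis al_chord : chord_diagram al.
Implicit Types x y : path_algebra k Q.

(** The matrix of [x] in the representation that sends the piece of [p] from its
    vertex number [l] to its vertex number [c] to the matrix unit in position
    [(l, c)]. *)
Definition part_matrix x : 'M[k]_n :=
  \matrix_(l, c) if (l <= c)%N then coef x (path_part p l c) else 0.

(** The ways to cut a piece of [p] are the vertices on it, so coefficients along pieces
    multiply as matrix entries do. *)
Lemma coef_part_mul x y (l c : nat) : (l <= c)%N -> (c < n)%N ->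
  coef (x * y) (path_part p l c) =
  \sum_(l <= r < c.+1) coef x (path_part p l r) * coef y (path_part p r c).
Proof.
move=> lc cn; rewrite coef_path_mul path_length_part //.
rewrite -[X in \sum_(X <= _ < _) _]add0n big_addn subSn // big_mkord; apply: eq_bigr => s _.
have sc : (s + l <= c)%N by rewrite -[X in (_ <= X)%N](subnK lc) leq_add2r -ltnS.
have ls : (l <= s + l)%N by rewrite leq_addl.
by rewrite -(path_take_part p ls sc) -(path_drop_part ls sc cn) addnK.
Qed.

Lemma part_matrixM x y : part_matrix (x * y) = part_matrix x *m part_matrix y.
Proof.
apply/matrixP => l c; rewrite !mxE; under eq_bigr => r _ do rewrite !mxE.
have [lc|cl] := leqP l c; last first.
  rewrite big1 // => r _; case: leqP => [lr|_]; last by rewrite mul0r.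
  case: leqP => [rc|_]; last by rewrite mulr0.
  by have := leq_trans lr rc; rewrite leqNgt cl.
rewrite coef_part_mul //.
rewrite (big_nat_widen _ _ n) ?ltn_ord // (big_nat_widenl _ 0) // big_mkord big_mkcond.
apply: eq_bigr => r _ /=.
by rewrite ltnS; case: (leqP r c); case: (leqP l r); rewrite ?mul0r ?mulr0.
Qed.

Lemma part_matrix1 : part_matrix 1 = 1%:M.
Proof.
apply/matrixP => l c; rewrite !mxE coef_path_one -size_eq0 -/(path_length _).
have cn : (c <= path_length p)%N by rewrite -ltnS ltn_ord.
by rewrite path_length_part // subn_eq0 -val_eqE /= eqn_leq; case: leqP.
Qed.

Lemma part_matrixP c x y : part_matrix (c *: x + y) = c *: part_matrix x + part_matrix y.
Proof.
apply/matrixP => l r; rewrite !mxE Defs.coefD Defs.coefZ.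
by case: leqP => // _; rewrite mulr0 addr0.
Qed.

Lemma in_ideal_part_matrix x : in_ideal x <-> part_matrix x = 0.
Proof.
rewrite in_idealP; split=> [h|h r /dom_p.2[l [c [lc cp ->]]]].
  apply/matrixP => l c; rewrite !mxE; case: leqP => // lc.
  exact/h/nonzero_drop/nonzero_take/(dom_p.1).
have ln := leq_trans lc cp.
have /matrixP/(_ (Ordinal (ln : (l < n)%N)) (Ordinal (cp : (c < n)%N))) := h.
by rewrite !mxE /= lc.
Qed.

Lemma path_part_trivial i : (i < n)%N ->
  path_part p i i = trivial_path (nth (path_source p) (path_vertices p) i).
Proof.
move=> ip; apply: qpath_eq; last first.
  by rewrite path_arrows_part drop_oversize // size_takel.
by rewrite path_source_part // (path_target_take (path_source p)).
Qed.

Lemma part_matrix_glued x : glued_triangular al (part_matrix x).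
Proof.
split=> [i j ji|i]; rewrite !mxE; first by rewrite leqNgt ji.
rewrite !leqnn !path_part_trivial ?ltn_ord //; congr (coef _ (trivial_path _)).
by apply/(vertex_eq al_assoc al_chord); right; case: al_chord => ->.
Qed.

(** A nontrivial piece is determined by its first arrow and its length; the trivial
    ones at [l] and [al l] agree. *)
Lemma path_part_eq (l c l' c' : 'I_n) : (l <= c)%N -> (l' <= c')%N ->
  path_part p l c = path_part p l' c' ->
  l = l' /\ c = c' \/ [/\ l = c, l' = c' & l' = al l].
Proof.
move=> lc lc' e; have := congr1 (@path_length Q) e.
rewrite !path_length_part -1?ltnS ?ltn_ord // => es.
move: lc; rewrite leq_eqVlt => /orP[/eqP/val_inj elc|lc].
  have elc' : l' = c'.
    apply/val_inj/eqP; rewrite eqn_leq lc' /= -subn_eq0 -es elc subnn //.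
  move: e; rewrite -elc -elc' !path_part_trivial ?ltn_ord // => /(congr1 (@path_source Q)).
  by move/(vertex_eq al_assoc al_chord) => [|]; [left|right].
left; have lt' : (l' < c')%N by rewrite -subn_gt0 -es subn_gt0.
have cs : (c <= size (path_arrows p))%N by rewrite -ltnS ltn_ord.
have cs' : (c' <= size (path_arrows p))%N by rewrite -ltnS ltn_ord.
have [a _] : exists a, a \in path_arrows p.
  case: (path_arrows p) cs lc => [|a s _ _]; first by rewrite leqn0 => /eqP->.
  by exists a; rewrite mem_head.
have := congr1 (fun q => nth a (path_arrows q) 0) e; rewrite !path_arrows_part.
rewrite !nth_drop !addn0 !nth_take // => /eqP.
rewrite nth_uniq ?(uniq_dominating dom_p) ?(leq_trans lc) ?(leq_trans lt') // => /eqP ell.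
split; apply: val_inj => //=.
by rewrite -[LHS](subnK (ltnW lc)) es ell subnK // ltnW.
Qed.

(** Take the combination of the pieces of [p] with the entries of [X] as coefficients;
    equal pieces have equal entries because [X] is glued. *)
Lemma part_matrix_surj X : glued_triangular al X -> exists x, part_matrix x = X.
Proof.
move=> [Xtri Xdiag].
pose P q (z : 'I_n * 'I_n) := (z.1 <= z.2)%N && (q == path_part p z.1 z.2).
pose g q := if [pick z | P q z] is Some z then X z.1 z.2 else 0.
pose L := undup [seq path_part p z.1 z.2 | z : 'I_n * 'I_n <- enum {: 'I_n * 'I_n}].
exists (\sum_(q <- L) g q *: of_path k q); apply/matrixP => l c; rewrite mxE.
case: leqP => [lc|cl]; last by rewrite Xtri.
set q0 := path_part p l c.
have q0L : q0 \in L.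
  by rewrite mem_undup; apply/mapP; exists (l, c); rewrite ?mem_enum.
rewrite Defs.coef_sum (bigD1_seq q0) ?undup_uniq //= Defs.coefZ coef_of_path eqxx mulr1.
rewrite big1 ?addr0 => [|q /negPf qq0]; last by rewrite Defs.coefZ coef_of_path qq0 mulr0.
rewrite /g; case: pickP => [[l' c'] /andP[/= lc' /eqP e]|/(_ (l, c))]; last first.
  by rewrite /P /= lc eqxx.
case: (path_part_eq lc lc' e) => [[-> ->]//|[<- <- ->]].
by rewrite Xdiag.
Qed.

Lemma triangular_presentation (A : algType k) : presents Q A ->
  exists T : triangular_model al A, True.
Proof.
move=> [f [f_scal f_surj f_ker]].
have /choice[g fg] := f_surj.
have fE x y : f x = f y <-> part_matrix x = part_matrix y.
  have subE : part_matrix (x - y) = part_matrix x - part_matrix y.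
    by rewrite addrC -scaleN1r part_matrixP scaleN1r addrC.
  split=> [e|e]; apply/eqP; rewrite -subr_eq0; apply/eqP.
    by rewrite -subE; apply/in_ideal_part_matrix/f_ker; rewrite rmorphB /= e subrr.
  by rewrite -rmorphB; apply/f_ker/in_ideal_part_matrix; rewrite subE e subrr.
have gf x : part_matrix (g (f x)) = part_matrix x by apply/fE; rewrite fg.
have hP c a b : part_matrix (g (c *: a + b)) = c *: part_matrix (g a) + part_matrix (g b).
  by rewrite -part_matrixP; apply/fE; rewrite fg rmorphD /= f_scal !fg.
have h1 : part_matrix (g 1) = 1%:M by rewrite -part_matrix1; apply/fE; rewrite fg rmorph1.
have hM a b : part_matrix (g (a * b)) = part_matrix (g a) *m part_matrix (g b).
  by rewrite -part_matrixM; apply/fE; rewrite fg rmorphM /= !fg.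
have hinj : injective (part_matrix \o g).
  by move=> a b /= /fE; rewrite !fg.
have hsurj X : glued_triangular al X -> exists a, part_matrix (g a) = X.
  by move=> /part_matrix_surj[x <-]; exists (f x).
by exists (@TriangularModel k n al A (part_matrix \o g) hP h1 hM hinj
  (fun a => part_matrix_glued (g a)) hsurj).
Qed.

End TriangularPresentation.

(** * Koszul duality *)

Lemma koszul_dualK (Q : bound_quiver) : koszul_dual (koszul_dual Q) = Q.
Proof.
case: Q => [[V E s t] r h].
set Q := BoundQuiver h; rewrite {1}/koszul_dual.
have rr' : @dual_relation (koszul_dual Q) = r.
  apply/funext => a; apply/funext => b; rewrite /dual_relation /= /dual_relation /=.
  have [st|st] := eqVneq (s b) (t a); first by rewrite /= negbK.
  by apply/esym/negP => rab; case/eqP: st; apply: esym (h _ _ rab).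
move: (@dual_relation_path (koszul_dual Q)); rewrite rr' => h'.
by rewrite /Q (Prop_irrelevance h h').
Qed.

Lemma locally_gentle_dual (k : fieldType) (Q : bound_quiver) :
  locally_gentle k Q -> locally_gentle k (koszul_dual Q).
Proof.
move=> [deg in_one notin_one].
have dual_in (b a : arrow Q) : @path2_in k (koszul_dual Q) b a -> path2_notin k a b.
  move=> [ba /(in_ideal_path2 k ba) /andP[/eqP ab nrel]]; split=> // /(in_ideal_path2 k ab).
  exact/negP.
have dual_notin (b a : arrow Q) : @path2_notin k (koszul_dual Q) b a -> path2_in k a b.
  move=> [ba nba]; have ab : is_path2 a b by [].
  split=> //; apply/in_ideal_path2 => //; apply: contraT => nrel; case: nba.
  by apply/(in_ideal_path2 k ba); rewrite /= /dual_relation nrel andbT; apply/eqP.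
split=> [v|a|a].
- by have [] := deg v.
- have [h1 h2] := notin_one a; split=> b c /dual_in hb /dual_in hc; [exact: h2|exact: h1].
- have [h1 h2] := in_one a; split=> b c /dual_notin hb /dual_notin hc; [exact: h2|exact: h1].
Qed.

(** A converse of the facts above on the arrows and vertices of a dominating path. *)
Section DominatesI.
Variables (Q : bound_quiver) (q : qpath Q).
Hypothesis q_nonzero : nonzero_path q.
Hypothesis mem_q : forall a, a \in path_arrows q.
Hypothesis follows_q : forall a b, follows a b ->
  index b (path_arrows q) = (index a (path_arrows q)).+1.
Hypothesis vertices_q : forall v, v \in path_vertices q.

Lemma dominatesI : dominates q.
Proof.
split=> // r; have [e|] := eqVneq (path_arrows r) [::].
  move=> _; have := vertices_q (path_source r); set v := path_source r => vq.
  have lt : (index v (path_vertices q) <= path_length q)%N.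
    by rewrite -ltnS -size_path_vertices index_mem.
  exists (index v (path_vertices q)), (index v (path_vertices q)); split=> //.
  apply: qpath_eq; last by rewrite path_arrows_part e drop_oversize // size_takel.
  by rewrite path_source_part // (path_target_take v) // nth_index.
case E : (path_arrows r) => [//|b s] _; rewrite /nonzero_path E => /= bs.
have [sz eq] : (index b (path_arrows q) + (size s).+1 <= path_length q)%N /\
    b :: s = take (size s).+1 (drop (index b (path_arrows q)) (path_arrows q)).
  elim: s b bs {E} => [|c s IH] b /=.
    move=> _; rewrite addn1 index_mem mem_q; split=> //.
    by rewrite (drop_nth b) ?index_mem ?mem_q //= nth_index ?take0.
  move=> /andP[/follows_q bc /IH[sz eq]]; rewrite bc in sz eq.
  split; first by rewrite addnS -addSn.
  by rewrite [in RHS](drop_nth b) ?index_mem ?mem_q //= nth_index // -eq.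
exists (index b (path_arrows q)), ((size s).+1 + index b (path_arrows q))%N.
split; [exact: leq_addl|by rewrite addnC|].
by apply: qpath_eq_arrows; rewrite E // path_arrows_part -take_drop -eq.
Qed.

End DominatesI.

Section DualPath.
Variables (k : fieldType) (Q : bound_quiver) (p : qpath Q).
Hypothesis dom_p : dominates p.
Local Notation n := (path_length p).+1.
Local Notation Qd := (koszul_dual Q).
Local Notation ar := (path_arrows p).
Variable al : 'S_n.
Hypothesis al_assoc : associated_perm p al.
Hypothesis al_chord : chord_diagram al.
Local Notation vx i := (nth (path_source p) (path_vertices p) i).
Local Notation tau := (syzygy_perm al).

(** Arrows are numbered by their sources on [p]; the last vertex is the position of no
    arrow. *)
Definition position (a : arrow Q) : 'I_n := inord (index a ar).

Lemma positionE a : position a = index a ar :> nat.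
Proof. by rewrite inordK // ltnW // ltnS index_mem mem_dominating. Qed.

Lemma position_lt a : ((position a).+1 < n)%N.
Proof. by rewrite positionE ltnS index_mem mem_dominating. Qed.

Lemma position_inj : injective position.
Proof.
move=> a b /(congr1 (@nat_of_ord _)); rewrite !positionE => e.
by rewrite -(nth_index a (mem_dominating dom_p a)) e nth_index ?mem_dominating.
Qed.

Lemma position_onto (i : 'I_n) : (i.+1 < n)%N -> exists a, position a = i.
Proof.
move=> lt; have : (i < size ar)%N by [].
case E : ar => [//|a0 s]; rewrite -E => si.
exists (nth a0 ar i); apply: val_inj; rewrite /= positionE.
by rewrite index_uniq // uniq_dominating.
Qed.

Lemma source_position a : source a = vx (position a).
Proof. by rewrite positionE -source_dominating. Qed.

Lemma target_position a : target a = vx (position a).+1.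
Proof. by rewrite positionE -target_dominating. Qed.

(** In the dual, [b] is followed by the arrow that ends where [b] starts without
    preceding it on [p]. *)
Lemma follows_dual (b a : arrow Q) :
  @follows Qd b a <-> al (position b) = (position a).+1 :> nat.
Proof.
have al_neq := al_chord.2 (position b).
have fE : @follows Qd b a <-> target a = source b /\ ~ follows a b.
  rewrite /follows /= /dual_relation; split=> [/andP[/eqP ba]|[ab]].
    by rewrite ba eqxx /= negbK => rab; split=> //; rewrite rab.
  by rewrite ab eqxx /= => /negP; rewrite !negbK.
rewrite fE (follows_dominating dom_p).
pose i' : 'I_n := Ordinal (position_lt a).
have -> : target a = vx i' by rewrite target_position.
have -> : source b = vx (position b) by rewrite source_position.
split=> [[/esym /(vertex_eq al_assoc al_chord) e ne]|e].
  case: e => e; last by rewrite -e.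
  by case: ne; rewrite -!positionE -e.
have ei : i' = al (position b) by apply: val_inj; rewrite /= -e.
split; first by apply/esym/(vertex_eq al_assoc al_chord); right.
rewrite -!positionE => e2; apply: al_neq; rewrite /isolated -ei.
by apply: val_inj; rewrite /= -e2.
Qed.

Lemma follows_dual_tau (b a : arrow Q) : @follows Qd b a -> position a = tau (position b).
Proof.
move=> /follows_dual e; apply: val_inj; apply/eqP; rewrite -eqSS /= -e eq_sym.
by rewrite syzygy_permS // e.
Qed.

(** The arrows along [q] are successive images under [tau], so their positions lie in
    one orbit. That orbit also contains the last vertex: otherwise [q] could be
    extended. *)
Lemma dual_dominated_maximal (q : qpath Qd) : dominates q -> maximal al.
Proof.
move=> dom_q; apply/(maximal_syzygy_perm ord0 al_chord.1).
have n1 : (0 < path_length p)%N.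
  rewrite lt0n; apply/eqP => p0; apply: (al_chord.2 ord0).
  have := ltn_ord (al ord0); rewrite ltnS [X in (_ <= X)%N]p0 leqn0 => /eqP e.
  exact: val_inj.
have [a0 _] : exists a, position a = ord0 by apply: position_onto.
pose L : seq (arrow Q) := path_arrows q.
have memL a : a \in L := mem_dominating dom_q a.
have sL : (0 < size L)%N by have := memL a0; rewrite -index_mem; apply: leq_ltn_trans.
pose b0 := nth a0 L 0.
have iterL j : (j < size L)%N -> position (nth a0 L j) = iter j tau (position b0).
  elim: j => [//|j IH] js /=; rewrite -IH; last exact: ltnW.
  by apply: follows_dual_tau; have /(sortedP a0)/(_ _ js) := dom_q.1.
have in_orbit i : i \in porbit tau (position b0).
  have [lt|] := ltnP i.+1 n.
    have [a <-] := position_onto lt.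
    rewrite -(nth_index a0 (memL a)) iterL ?index_mem // -permX.
    exact: mem_porbit.
  move=> ni; have iE : i.+1 = n by apply/eqP; rewrite eqn_leq ni ltn_ord.
  pose bl := nth a0 L (size L).-1.
  have lL : ((size L).-1 < size L)%N by rewrite prednK.
  have al0 : al (position bl) = 0%N :> nat.
    apply/eqP; rewrite -leqn0 leqNgt; apply/negP => al_pos.
    have lt : ((tau (position bl)).+1 < n)%N by rewrite syzygy_permS.
    have [a aE] := position_onto lt.
    have /(follows_dominating dom_q) : @follows Qd bl a.
      by apply/follows_dual; rewrite aE syzygy_permS.
    rewrite -/L index_uniq ?(uniq_dominating dom_q) // prednK // => e.
    by have := memL a; rewrite -index_mem e ltnn.
  have -> : i = tau (position bl).
    by apply: val_inj; apply/eqP; rewrite -eqSS /= iE syzygy_perm0.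
  by rewrite iterL // -iterS -permX mem_porbit.
move=> x y; have := in_orbit x; rewrite -eq_porbit_mem => /eqP e.
by have := in_orbit y; rewrite -e.
Qed.

End DualPath.

Section MaximalDual.
Variables (k : fieldType) (Q : bound_quiver) (p : qpath Q).
Hypothesis dom_p : dominates p.
Local Notation n := (path_length p).+1.
Local Notation Qd := (koszul_dual Q).
Local Notation ar := (path_arrows p).
Variable al : 'S_n.
Hypothesis al_assoc : associated_perm p al.
Hypothesis al_chord : chord_diagram al.
Local Notation vx i := (nth (path_source p) (path_vertices p) i).
Local Notation tau := (syzygy_perm al).
Hypothesis al_max : maximal al.

(** Starting from the last vertex, which is the position of no arrow, an orbit of length
    [n] lists all the arrows. *)
Definition orbit_point (t : nat) : 'I_n := iter t tau ord_max.
Local Notation e := orbit_point.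

Let tau_one : one_porbit tau.
Proof. exact/(maximal_syzygy_perm ord_max al_chord.1). Qed.

Let card_orbit : #|porbit tau ord_max| = n.
Proof. by rewrite card_porbit_full ?card_ord. Qed.

Lemma orbit_point_inj t t' : (t < n)%N -> (t' < n)%N -> e t = e t' -> t = t'.
Proof.
move=> tn t'n eq; apply/eqP; have := uniq_traject_porbit tau ord_max.
rewrite card_orbit => u.
by rewrite -(nth_uniq ord_max _ _ u) ?size_traject // !nth_traject // -/(e _) eq.
Qed.

Lemma orbit_point_onto i : exists2 t, (t < n)%N & e t = i.
Proof.
have := tau_one ord_max i; rewrite porbit_traject card_orbit => /trajectP[t tn ->].
by exists t.
Qed.

Lemma orbit_point_lt t : (0 < t)%N -> (t < n)%N -> ((e t).+1 < n)%N.
Proof.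
move=> t0 tn; rewrite ltn_neqAle ltn_ord andbT; apply/eqP => e0.
have : e t = e 0%N by apply: val_inj; case: e0.
by move/(orbit_point_inj tn (ltn0Sn _)) => t00; rewrite t00 in t0.
Qed.

Lemma orbit_point_al t : (t.+1 < n)%N -> al (e t) = (e t.+1).+1 :> nat.
Proof.
move=> tn; have [al0|al_pos] := posnP (al (e t)).
  have := orbit_point_lt (ltn0Sn t) tn.
  by rewrite -[X in (_ < X)%N](syzygy_perm0 al0) ltnn.
by rewrite -syzygy_permS.
Qed.

Lemma maximal_dual_path : exists2 q : qpath Qd, dominates q &
  path_length q = path_length p /\
  forall t, (t < n)%N -> nth (path_source q) (path_vertices q) t = vx (e t).
Proof.
have n1 : (1 < n)%N.
  rewrite ltnS lt0n; apply/eqP => p0; apply: (al_chord.2 ord0).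
  have := ltn_ord (al ord0); rewrite ltnS [X in (_ <= X)%N]p0 leqn0 => /eqP e0.
  exact: val_inj.
have [a0 _] := position_onto dom_p (orbit_point_lt (ltn0Sn 0) n1).
pose arr t := nth a0 ar (e t).
have arrP t : (0 < t)%N -> (t < n)%N -> position p (arr t) = e t.
  move=> t0 tn; apply: val_inj; rewrite /= positionE // index_uniq ?uniq_dominating //.
  exact: orbit_point_lt.
pose L : seq (arrow Qd) := [seq arr t | t <- iota 1 (path_length p)].
have szL : size L = path_length p by rewrite size_map size_iota.
have nthL t : (t < path_length p)%N -> nth a0 L t = arr t.+1.
  by move=> tn; rewrite (nth_map 0%N) ?size_iota // nth_iota.
have uL : uniq L.
  rewrite map_inj_in_uniq ?iota_uniq // => t t'; rewrite !mem_iota.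
  move=> /andP[t1 tn] /andP[t1' tn'] /(congr1 (position p)).
  by rewrite !arrP //; apply: orbit_point_inj.
have sL : sorted (@follows Qd) L.
  apply/(sortedP a0) => t; rewrite szL => tn.
  rewrite !nthL //; last exact: ltnW.
  apply/(follows_dual dom_p al_assoc al_chord); rewrite !arrP ?orbit_point_al //.
  exact: ltnW.
have L0 : L != [::] by rewrite -size_eq0 szL -lt0n.
have [q q_nz qE] := sorted_nonzero_path L0 sL.
have idx a : exists2 t, (t < path_length p)%N & a = nth a0 L t.
  have [t tn et] := orbit_point_onto (position p a).
  have := position_lt dom_p a; rewrite -et.
  case: t tn et => [|t] tn et; first by rewrite ltnn.
  move=> _; exists t => //; rewrite nthL //; apply: (position_inj dom_p).
  by rewrite arrP.
have vq t : (t < n)%N -> nth (path_source q) (path_vertices q) t = vx (e t).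
  case: t => [_|t tn].
    transitivity (path_source q); first by [].
    have := path_valP q; rewrite -/(path_arrows q) -/(path_source q) qE.
    have -> : L = arr 1%N :: behead L by rewrite /L; case: (path_length p) n1.
    move=> /andP[/eqP <- _]; rewrite [LHS](target_position dom_p) arrP //.
    rewrite -orbit_point_al //; apply/(vertex_eq al_assoc al_chord).
    by right; case: al_chord => ->.
  rewrite [LHS]/= qE (nth_map a0) ?szL // nthL //.
  by rewrite [LHS](source_position dom_p) arrP.
exists q; last by split=> //; rewrite /path_length qE.
apply: dominatesI => // [a|b a|v]; rewrite ?qE.
- by have [t tn ->] := idx a; rewrite mem_nth ?szL.
- move=> ba; have := follows_dual_tau dom_p al_assoc al_chord ba.
  have [t tn bE] := idx b; have [t' tn' aE] := idx a.
  rewrite aE bE !index_uniq ?szL // !nthL // !arrP // => et.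
  have {}et : e t'.+1 = e t.+2 := et.
  have [eq|lt] := eqVneq t.+2 n; last first.
    by apply: succn_inj; apply: orbit_point_inj et; rewrite // ltn_neqAle lt.
  (* The orbit closes up at the last vertex, where no arrow starts. *)
  have := orbit_point_lt (ltn0Sn t') tn'; rewrite et.
  have -> : e t.+2 = ord_max.
    by rewrite /e [X in iter X]eq -[X in iter X]card_orbit iter_porbit.
  by rewrite ltnn.
- have [i i_n ->] := vertex_dominating dom_p v.
  have [t tn et] := orbit_point_onto (Ordinal i_n).
  have -> : vx i = vx (e t) by rewrite et.
  rewrite -vq // mem_nth // size_path_vertices [path_length q]/path_length qE szL.
  exact: tn.
Qed.

(** The vertices of the dual path are those of [p] listed along the orbit, so its
    quasi-diagram is [al] conjugated by that enumeration. *)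
Lemma maximal_dual : locally_gentle k Q ->
  exists2 be : 'S_n, chord_diagram be & gentle_one_maximal_path k Qd be.
Proof.
move=> lg; have [q dom_q [lq vq]] := maximal_dual_path.
have inj_e : injective (fun t : 'I_n => e t).
  by move=> t t' /(orbit_point_inj (ltn_ord t) (ltn_ord t'))/val_inj.
pose eps := perm inj_e; exists (al ^ eps^-1)%g.
  by split=> i; rewrite -[i](permK eps) /isolated !permJ;
    [rewrite al_chord.1|move/perm_inj; apply: al_chord.2].
have beE t : eps ((al ^ eps^-1)%g t) = al (eps t).
  by rewrite -[t in LHS](permK eps) permJ permKV.
apply/one_maximal_pathP; split; first exact: locally_gentle_dual.
exists q => //; split; first by rewrite lq.
move=> i.
have vE (j l : 'I_n) : nth (path_source q) (path_vertices q) j =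
    nth (path_source q) (path_vertices q) l <-> j = l \/ j = (al ^ eps^-1)%g l.
  rewrite !vq //.
  have epsE (t : 'I_n) : e t = eps t by rewrite permE.
  rewrite !epsE; split=> [/esym/(vertex_eq al_assoc al_chord)[/perm_inj|]|[->|->]] //.
  - by left.
  - by rewrite -beE => /perm_inj; right.
  - by apply/esym/(vertex_eq al_assoc al_chord); right; rewrite beE.
split=> [j ji /vE[e1|->//]|ne]; first by rewrite e1 eqxx in ji.
have [//|nb] := eqVneq ((al ^ eps^-1)%g i) i.
by case: (ne _ nb); apply/vE; right.
Qed.

End MaximalDual.

(** * The equivalences *)

Lemma koszul_dual_exists (k : fieldType) (Q : bound_quiver) n (al : 'S_n) :
  chord_diagram al -> maximal al -> gentle_one_maximal_path k Q al ->
  exists2 be : 'S_n, chord_diagram be & gentle_one_maximal_path k (koszul_dual Q) be.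
Proof.
move=> hal al_max /one_maximal_pathP[lg [p dom_p al_p]]; have en := al_p.1.
by case: n / en al hal al_max al_p => al hal al_max al_p; apply: (maximal_dual dom_p al_p).
Qed.

Lemma koszul_dual_maximal (k : fieldType) (Q : bound_quiver) n (al : 'S_n)
    n' (be : 'S_n') :
  chord_diagram al -> gentle_one_maximal_path k Q al ->
  gentle_one_maximal_path k (koszul_dual Q) be -> maximal al.
Proof.
move=> hal /one_maximal_pathP[lg [p dom_p al_p]] /one_maximal_pathP[_ [q dom_q _]].
have en := al_p.1; case: n / en al hal al_p => al hal al_p.
exact: (dual_dominated_maximal dom_p al_p hal dom_q).
Qed.

Lemma has_triangular_model (k : fieldType) (A : algType k) n (al : 'S_n) :
  chord_diagram al -> has_quasi_diagram A al -> exists T : triangular_model al A, True.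
Proof.
move=> hal [Q [/one_maximal_pathP[lg [p dom_p al_p]] prQ]].
have en := al_p.1; case: n / en al hal al_p => al hal al_p.
exact: (triangular_presentation dom_p al_p hal prQ).
Qed.

Section GlobalDimensionMaximal.
Variables (k : fieldType) (n : nat) (al : 'S_n.+1) (A : algType k).
Variable T : triangular_model al A.
Hypothesis al_chord : chord_diagram al.
Local Notation tau := (syzygy_perm al).

Lemma iter_al0 t i : al (iter t tau i) = 0%N :> nat <-> iter t.+1 tau i = ord_max.
Proof.
split=> [/syzygy_perm0[e]|e]; first exact: val_inj.
by apply: syzygy_perm_last; rewrite -[RHS]/((ord_max : 'I_n.+1).+1) -e.
Qed.

Lemma maximal_gldim_le : maximal al -> gldim_le A n.
Proof.
move=> /(maximal_syzygy_perm ord_max al_chord.1) tau1 M; apply/projdim_leP.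
apply: (pd_lt_all T al_chord.1 al_chord.2 (tau := tau)) => [i|i lt].
  exact: syzygy_permS.
have := tau1 i ord_max; rewrite porbit_traject card_porbit_full // card_ord.
move=> /trajectP[[|t] tn e]; first by rewrite -[i]e ltnn in lt.
by exists t => //; apply/iter_al0; rewrite e.
Qed.

(** Otherwise the syzygies of [Umod T k^o i.+1] are not projective up to step [d]. *)
Lemma gldim_le_reaches d i : gldim_le A d ->
  exists2 t, (t <= d)%N & iter t.+1 tau i = ord_max.
Proof.
move=> hd; have /projdim_leP := hd (Umod T k^o i.+1).
move=> /(pd_lt_reaches_zero al_chord.1 al_chord.2 (@syzygy_permS _ al))[t td /iter_al0 e].
by exists t.
Qed.

Lemma gldim_maximal : maximal al <-> gldim_eq A n.
Proof.
have mP := maximal_syzygy_perm ord_max al_chord.1.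
split=> [hmax|[hn _]].
  split=> [|d /(gldim_le_reaches ord_max)[t td e]]; first exact: maximal_gldim_le.
  have /mP tau1 := hmax; have := one_porbit_period tau1 (ltn0Sn t) e.
  by rewrite card_ord ltnS => /leq_trans; apply.
apply/mP => x y.
have reach z : porbit tau z = porbit tau ord_max.
  have [t _ e] := gldim_le_reaches z hn.
  by rewrite -e -permX porbit_perm.
by rewrite -eq_porbit_mem !reach.
Qed.

End GlobalDimensionMaximal.

Theorem proposition6p3 (k : closedFieldType) (hk : [pchar k] =i pred0)
    (m : nat) (hm : (1 <= m)%N) (al : 'S_(2 * m)%N) (hal : chord_diagram al)
    (A : algType k) (hA : has_quasi_diagram A al) :
  [<-> maximal al;
       regular al;
       rotatably_regular al;
       forall l : int, maximal (rotation l al);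
       exists (n : nat) (be : 'S_n), is_koszul_dual k al be;
       exists (n : nat) (be : 'S_n),
         [/\ chord_diagram be, maximal be & is_koszul_dual k be al];
       gldim_eq A (2 * m - 1)%N] /\
  (maximal al -> ~~ odd m).
Proof.
split; last exact: maximal_even.
have n0 : (0 < 2 * m)%N by rewrite muln_gt0.
pose x0 := Ordinal n0.
have gl : maximal al <-> gldim_eq A (2 * m - 1)%N.
  have [T _] := has_triangular_model hal hA.
  move: (2 * m)%N al hal n0 T {hm hA x0} => [//|n] al' hal' _ T.
  by rewrite subn1; apply: gldim_maximal.
have [Q [Qal _]] := hA.
(* The roles of [al] and [be] are exchanged by duality. *)
have max1 (be : 'S_(2 * m)) : chord_diagram be -> is_koszul_dual k al be -> maximal be.
  move=> hbe [Q' [Q'al Q'be]]; apply: koszul_dual_maximal hbe Q'be _.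
  by rewrite koszul_dualK; exact: Q'al.
tfae.
- exact: maximal_regular.
- move=> /(regular_maximal x0 hal) al_max l.
  exact/maximal_regular/maximal_rotation.
- move=> hreg l; apply: (regular_maximal x0); first exact: chord_rotation.
  exact: hreg.
- move=> /(_ 0); rewrite rotationE conjg1 => al_max.
  have [be _ Qbe] := koszul_dual_exists hal al_max Qal.
  by exists (2 * m)%N, be, Q.
- move=> [n [be [Q1 [Q1al Q1be]]]].
  have al_max := koszul_dual_maximal hal Q1al Q1be.
  have [ga hga Qga] := koszul_dual_exists hal al_max Qal.
  exists (2 * m)%N, ga; split=> //; first by apply: max1 => //; exists Q.
  by exists (koszul_dual Q); rewrite koszul_dualK.
- move=> [n [be [_ _ [Q1 [Q1be Q1al]]]]]; apply/gl.
  by apply: (koszul_dual_maximal hal Q1al); rewrite koszul_dualK; exact: Q1be.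
- by move/gl.
Qed.
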